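(* Fix $\delta\in(0,1)$, an integer $d\ge2$, $N\ge1$, $n=N^d$, $\beta>0$ and $\sigma>0$. Let $f^*\in PC(d,\beta)$ be an unknown function, let $\theta^*_{\boldsymbol i}=f^*(x_{\boldsymbol i})$ for $\boldsymbol i\in[N]^d$, and let $y=\theta^*+\varepsilon$ with $\varepsilon\sim\mathcal N(0,\sigma^2I_n)$. There exist positive constants $c$ and $C$ such that the following holds. Put $r_2(n)=\log n$ and $r_d(n)=1$ for $d\ge3$, let $\lambda=c\,\sigma\sqrt{r_d(n)\log(en/\delta)}/n$, and let $$\hat\theta\in\operatorname*{argmin}_{\theta\in\mathbb{R}^n}\ \frac1n\|\theta-y\|_2^2+\lambda\|D_d\theta\|_1,$$ where $D_d$ is the incidence matrix of the $d$-dimensional $N^d$ grid. Let $\hat f:[0,1]^d\to\mathbb{R}$ be defined by $\hat f(x_{\boldsymbol i})=\hat\theta_{\boldsymbol i}$ for $\boldsymbol i\in[N]^d$ and arbitrarily elsewhere on $[0,1]^d$. Then, with probability at least $1-2\delta$, $$\|\hat f-f^*\|_n^2\le C\left(\frac{\sigma^2\beta}{n^{1/d}}\,r_d(n)\log(en/\delta)+\frac{\sigma^2}{n}\log(e/\delta)\right).$$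
   Context: Grid points: $x_{\boldsymbol i}=\boldsymbol i/N$ for $\boldsymbol i\in[N]^d$, $[N]=\{1,\dots,N\}$. For a function $f$ on $[0,1]^d$, $\|f\|_n^2=\frac1n\sum_{\boldsymbol i\in[N]^d}f(x_{\boldsymbol i})^2$. Piecewise constant functions: for $\beta>0$, a function $f:\mathbb{R}^d\to\mathbb{R}$ belongs to $PC(d,\beta)$ if there is an associated boundary set $B(f)\subseteq[0,1]^d$ such that (1) $f$ is locally constant on $[0,1]^d\setminus B(f)$, i.e. for all $x\in[0,1]^d\setminus B(f)$ there is $\epsilon>0$ such that $f(x)=f(y)$ for all $y$ with $\|y-x\|<\epsilon$; (2) the covering number $N(r)$ of $B(f)$, i.e. the minimum number of Euclidean balls of radius $r$ needed to cover $B(f)$, satisfies $N(r)\le\beta r^{-(d-1)}$. The $d$-dimensional grid has vertex set $[N]^d$ (identified with $[n]$), with an edge between two vertices iff their difference is $\pm$ a standard basis vector. Its incidence matrix $D_d$ has one row per edge, with entries $1$ and $-1$ at the two endpoints and zeros elsewhere. Constants $c,C$ are generic (they may depend on the fixed dimension $d$, but not on $n$, $\delta$, $\sigma$, $\beta$ or $f^*$). *)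

(* Defs.v *)
From HB Require Import structures.
From mathcomp Require Import all_boot all_order all_algebra.
From mathcomp Require Import all_classical all_reals all_analysis.
Import Order.TTheory GRing.Theory Num.Theory.
Import numFieldNormedType.Exports.

Set Implicit Arguments.
Unset Strict Implicit.
Unset Printing Implicit Defensive.

Local Open Scope classical_set_scope.
Local Open Scope ring_scope.

(* The library norm on matrices is the sup norm; the Euclidean and l1 norms are
   introduced here for row and column vectors alike. *)
Definition norm2 (R : realType) (m n : nat) (A : 'M[R]_(m, n)) : R :=
  Num.sqrt (\sum_(i < m) \sum_(j < n) A i j ^+ 2).

Definition norm1 (R : realType) (m n : nat) (A : 'M[R]_(m, n)) : R :=
  \sum_(i < m) \sum_(j < n) `|A i j|.

Definition unit_cube (R : realType) (d : nat) : set 'rV[R]_d :=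
  [set x : 'rV[R]_d | forall k, 0 <= x ord0 k <= 1].
Arguments unit_cube {R d}.

Definition ball2 (R : realType) (d : nat) (a : 'rV[R]_d) (r : R) :
  set 'rV[R]_d := [set x : 'rV[R]_d | norm2 (x - a) <= r].

(* Extended-real valued: +oo when no finite cover exists. *)
Definition covering_number (R : realType) (d : nat) (B : set 'rV[R]_d) (r : R) :
    \bar R :=
  ereal_inf [set (k%:R)%:E | k in
    [set k : nat | exists a : 'I_k -> 'rV[R]_d,
       B `<=` \bigcup_(j in [set: 'I_k]) ball2 (a j) r]].

(* Radii range over ]0, 1]: for large r the bound is < 1, so that imposing it
   for all r > 0 would force the boundary set to be empty. *)
Definition piecewise_constant (R : realType) (d : nat) (beta : R)
    (f : 'rV[R]_d -> R) : Prop :=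
  exists B : set 'rV[R]_d,
    [/\ B `<=` unit_cube,
        forall x, (unit_cube `\` B) x ->
          exists2 e : R, 0 < e & forall y, norm2 (y - x) < e -> f x = f y
      & forall r : R, 0 < r <= 1 ->
          (covering_number B r <= (beta / r ^+ d.-1)%:E)%E].

(* The coordinate value k : 'I_N stands for k.+1 in {1, ..., N}. *)
Definition grid (N d : nat) : finType := {ffun 'I_d -> 'I_N}.

Definition grid_point (R : realType) (N d : nat) (i : grid N d) : 'rV[R]_d :=
  \row_k ((i k).+1%:R / N%:R).

(* v - u is a standard basis vector; each undirected edge {u, v} is represented
   by exactly one such ordered pair. *)
Definition grid_step (N d : nat) (u v : grid N d) : bool :=
  [exists k, (v k == (u k).+1 :> nat) &&
             [forall l, (l != k) ==> (v l == u l)]].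

Definition grid_edges (N d : nat) : {set grid N d * grid N d} :=
  [set e | grid_step e.1 e.2]%SET.

(* Column vectors indexed by 'I_#|grid N d| play the role of R^n. *)
Definition incidence (R : realType) (N d : nat) :
    'M[R]_(#|grid_edges N d|, #|grid N d|) :=
  \matrix_(e, v) ((enum_val v == (enum_val e).1)%:R
                  - (enum_val v == (enum_val e).2)%:R).

Definition sample (R : realType) (N d : nat) (f : 'rV[R]_d -> R) :
    'cV[R]_#|grid N d| :=
  \col_v f (grid_point R (enum_val v)).

Definition empirical_sqnorm (R : realType) (N d : nat) (f : 'rV[R]_d -> R) : R :=
  (N ^ d)%:R^-1 * \sum_(i : grid N d) f (grid_point R i) ^+ 2.

Definition tv_objective (R : realType) (N d : nat) (lambda : R)
    (y theta : 'cV[R]_#|grid N d|) : R :=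
  (N ^ d)%:R^-1 * norm2 (theta - y) ^+ 2
  + lambda * norm1 (incidence R N d *m theta).

Definition is_argmin (T : Type) (R : realType) (F : T -> R) (x : T) : Prop :=
  forall x', F x <= F x'.

Definition mutually_independent (disp : measure_display)
    (T : measurableType disp) (R : realType) (P : probability T R)
    (I : finType) (X : I -> {RV P >-> R}) : Prop :=
  forall (J : {set I}) (A : I -> set R), (forall i, measurable (A i)) ->
    P (\bigcap_(i in [set i | i \in J]) (X i @^-1` A i))
    = (\prod_(i in J) P (X i @^-1` A i))%E.

(* Law N(0, sigma^2 I_m); the second parameter of normal_prob is the standard
   deviation. *)
Definition isotropic_gaussian (disp : measure_display)
    (T : measurableType disp) (R : realType) (P : probability T R)
    (m : nat) (sigma : R) (X : 'I_m -> {RV P >-> R}) : Prop :=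
  mutually_independent X /\
  forall (i : 'I_m) (A : set R), measurable A ->
    distribution P (X i) A = normal_prob 0 sigma A.

Definition with_prob_ge (disp : measure_display)
    (T : measurableType disp) (R : realType) (P : probability T R)
    (p : R) (E : set T) : Prop :=
  exists A : set T, [/\ measurable A, A `<=` E & (p%:E <= P A)%E].

Definition rfactor (R : realType) (d n : nat) : R :=
  if d == 2%N then ln n%:R else 1.

(* Main.v *)
Require Import Defs.
From HB Require Import structures.
From mathcomp Require Import all_boot all_order all_algebra.
From mathcomp Require Import all_classical all_reals all_analysis.
From mathcomp Require Import measurable_realfun zify ring lra.
Import Order.TTheory GRing.Theory Num.Theory.
Import numFieldNormedType.Exports.

(** The total variation penalty is analysed through a flow on the grid.  For
    each vertex v let a unit of mass travel from v to every vertex w, weighted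
    by 1 / n, along a discretised straight segment, and let [flow e v] be the net
    mass crossing the edge e.  Telescoping along the paths gives, for every
    function D on the grid,

      D v - mean D = sum over edges e of flow e v * (D e.1 - D e.2),

    so that [flow] is a left inverse of the incidence matrix modulo constants
    ([flow_divergence]); it does the work of the pseudo-inverse without any
    spectral computation.  Its use is that the noise, tested against D, splits
    into the mean of the noise times the mean of D, plus a sum over edges of
    Z_e * (D e.1 - D e.2) with Z_e the Gaussian variable
    sum_v flow e v * eps_v.

    The variance of Z_e is governed by the energy sum_v (flow e v)^2.  At time t
    a path started at v is roughly uniform in a cube of side t, so a given edge
    is crossed with probability O(t^-d), and only from the O(t^d) vertices v at
    distance O(t).  Grouping the double sum over times by its larger index s
    leaves sum_(s <= N) s^(1-d) ([flow_energy_sum]), that is log n when d = 2 and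
    a constant when d >= 3: this is where the factor r_d(n) comes from.

    The other ingredients are the following.
    - A Chernoff bound for linear combinations of independent Gaussians
      ([gaussian_tail]) and a union bound over the edges yield an event of
      probability at least 1 - 2 delta on which n lambda dominates every
      2 |Z_e| and the mean of the noise is small ([noise_event]).
    - On that event the basic inequality for the minimiser leaves only the edges
      across which f* jumps; the degree bound absorbs the remaining
      gradient of the error into its own norm
      ([tv_oracle_inequality]).
    - A jump across an edge forces the edge to meet the boundary of f*.  A cover
      of the boundary by beta N^(d-1) balls of radius 1 / N meets at most
      25^d beta N^(d-1) edges ([card_jump_edges_le]). *)

Set Implicit Arguments.
Unset Strict Implicit.
Unset Printing Implicit Defensive.

Local Open Scope classical_set_scope.
Local Open Scope ring_scope.

(** * Integrals against a density *)

Section integral_density.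
Import HBNNSimple.
Local Open Scope ereal_scope.

(** One approximation by simple functions serves twice: with mu the Lebesgue
    measure, X the identity and G a density it computes integrals against the
    measure of density G; with mu a probability, nu the law of X and G a function
    of the variables independent of X it factors an expectation. *)
Lemma integral_density (d d' : measure_display) (T : measurableType d)
    (T' : measurableType d') (R : realType) (mu : {measure set T -> \bar R})
    (nu : {measure set T' -> \bar R}) (G : T -> R) (X : T -> T') (f : T' -> R)
    (c : R) :
  measurable_fun setT G -> (forall w, (0 <= G w)%R) ->
  measurable_fun setT X -> (0 <= c)%R ->
  measurable_fun setT f -> (forall x, (0 <= f x)%R) ->
  (forall A : set T', measurable A ->
     \int[mu]_w (G w * \1_A (X w))%:E = c%:E * nu A) ->
  \int[mu]_w (G w * f (X w))%:E = c%:E * \int[nu]_x (f x)%:E.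
Proof.
move=> mG G0 mX c0 mf f0 HA.
have mfE : measurable_fun setT (EFin \o f) by exact/measurable_EFinP.
pose h := nnsfun_approx measurableT mfE.
have h0 n x : (0 <= h n x)%R by [].
have mh n : measurable_fun setT (h n : T' -> R) by exact: measurable_funP.
have hf x : (h n x)%:E @[n --> \oo] --> (f x)%:E.
  by apply: (cvg_nnsfun_approx measurableT mfE) => //= y _; rewrite lee_fin.
have fh x : (f x)%:E = limn (fun n => (h n x)%:E) by apply/esym/cvg_lim.
have ndh x : nondecreasing_seq (fun n => h n x).
  by move=> a b ab; exact/lefP/nd_nnsfun_approx.
have hstep n : \int[mu]_w (G w * h n (X w))%:E
    = c%:E * \int[nu]_x (h n x)%:E.
  have dec x : (h n x)%:E
      = \sum_(y \in range (h n)) (y * \1_(h n @^-1` [set y]) x)%:E.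
    by rewrite fimfunE -fsumEFin.
  have mA y : measurable (h n @^-1` [set y]) by exact: measurable_sfunP.
  have ind0 y x : 0 <= (y * \1_(h n @^-1` [set y]) x)%:E.
    exact: nnfun_muleindic_ge0.
  have mAX y : measurable_fun setT
      (fun w => \1_(h n @^-1` [set y]) (X w) : R).
    by apply: (measurableT_comp (f := \1_(h n @^-1` [set y]) : T' -> R)).
  have -> : \int[nu]_x (h n x)%:E = \int[nu]_x (\sum_(y \in range (h n))
      (y * \1_(h n @^-1` [set y]) x)%:E).
    by apply: eq_integral => w _; exact: dec.
  rewrite ge0_integral_fsum//; last first.
    by move=> y; apply/measurable_EFinP; apply: measurable_funM.
  transitivity (\int[mu]_w (\sum_(y \in range (h n))
      ((G w)%:E * (y * \1_(h n @^-1` [set y]) (X w))%:E))).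
    by apply: eq_integral => w _; rewrite EFinM dec ge0_mule_fsumr.
  rewrite ge0_integral_fsum//; last 2 first.
  - move=> y; apply/measurable_EFinP; apply: measurable_funM => //.
    by apply: measurable_funM.
  - by move=> y w _; rewrite mule_ge0// lee_fin.
  rewrite ge0_mule_fsumr; last first.
    by move=> y; apply: integral_ge0 => w _; exact: ind0.
  apply: eq_fsbigr => y; rewrite inE => -[x _ hxy].
  have y0 : (0 <= y)%R by rewrite -hxy.
  transitivity (\int[mu]_w (y%:E * (G w * \1_(h n @^-1` [set y]) (X w))%:E)).
    by apply: eq_integral => w _; rewrite -!EFinM mulrCA.
  rewrite ge0_integralZl//; last 2 first.
  - by apply/measurable_EFinP; apply: measurable_funM.
  - by move=> w _; rewrite lee_fin mulr_ge0.
  rewrite HA//; under [X in _ = _ * X]eq_integral do rewrite EFinM.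
  rewrite ge0_integralZl//; last exact/measurable_EFinP.
  by rewrite muleCA integral_indic ?setIT.
transitivity (limn (fun n => \int[mu]_w (G w * h n (X w))%:E)).
  rewrite -monotone_convergence//.
  - apply: eq_integral => w _; rewrite EFinM; apply/esym/cvg_lim => //.
    by under eq_fun do rewrite EFinM; exact: cvgeZl.
  - move=> n; apply/measurable_EFinP; apply: measurable_funM => //.
    exact: measurableT_comp.
  - by move=> n w _; rewrite lee_fin mulr_ge0.
  - by move=> w _ a b ab; rewrite lee_fin ler_wpM2l// ndh.
under eq_fun do rewrite hstep.
apply/cvg_lim => //; apply: cvgeZl => //.
have -> : \int[nu]_x (f x)%:E = \int[nu]_x (limn (fun n => (h n x)%:E)).
  by apply: eq_integral => w _.
apply: (@cvg_monotone_convergence _ _ _ nu setT measurableT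
  (fun n x => (h n x)%:E)) => //.
- by move=> n; exact/measurable_EFinP.
- by move=> n w _; rewrite lee_fin.
- by move=> w _ a b ab; rewrite lee_fin ndh.
Qed.

End integral_density.

(** * Products of independent random variables *)

Section independent_products.
Local Open Scope ereal_scope.

(** Independence is given on indicators only.  The induction on [s] replaces the
    indicators by general functions one variable at a time, the others
    being frozen in the weight of [integral_density]; the sets A carry the
    induction because the hypothesis is then used at every set for the variable
    under treatment. *)
Lemma integral_prod_indep_partial (disp : measure_display)
    (T : measurableType disp) (R : realType) (P : probability T R) (I : finType)
    (X : I -> {RV P >-> R}) (f : I -> R -> R) (m : I -> R) (s : seq I)
    (A : I -> set R) :
  mutually_independent X ->
  (forall i, measurable_fun [set: R] (f i)) -> (forall i x, (0 <= f i x)%R) ->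
  (forall i, \int[P]_w (f i (X i w))%:E = (m i)%:E) ->
  (forall i, measurable (A i)) -> uniq s ->
  \int[P]_w (\prod_(i <- s) f i (X i w)
             * \prod_(i | i \notin s) \1_(A i) (X i w))%:E
  = (\prod_(i <- s) m i
     * \prod_(i | i \notin s) fine (P (X i @^-1` A i)))%:E.
Proof.
move=> indX mf f0 fm; elim: s A => [|k s IH] A mA.
  move=> _; rewrite big_nil mul1r.
  have -> : (\prod_(i | i \notin [::]) fine (P (X i @^-1` A i)))%:E
      = \prod_(i in [set: I]%SET) P (X i @^-1` A i).
    rewrite (eq_bigl xpredT); last by move=> i; rewrite in_nil.
    rewrite [RHS](eq_bigl xpredT); last by move=> i; rewrite finset.inE.
    rewrite (big_morph _ (@EFinM R) erefl); apply: eq_bigr => i _.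
    by rewrite fineK// fin_num_measure// -[_ @^-1` _]setTI; apply: measurable_funP.
  rewrite -indX//.
  under eq_integral => w _.
    rewrite big_nil mul1r.
    have -> : (\prod_(i | i \notin [::]) \1_(A i) (X i w))%R
       = \1_(\bigcap_(i in [set i | i \in [set: I]%SET]) (X i @^-1` A i)) w :> R.
      have [wA|wA] := pselect ((\bigcap_(i in [set i | i \in [set: I]%SET])
        (X i @^-1` A i)) w).
        rewrite [RHS]indicE mem_set//= big1// => i _.
        by rewrite indicE mem_set//; apply: wA => /=; rewrite finset.inE.
      rewrite [RHS]indicE memNset//=.
      have /existsNP[i /not_implyP[_ iA]] := wA.
      rewrite (bigD1 i)/= ?in_nil// indicE memNset//= mul0r//.
    over.
  rewrite integral_indic ?setIT//.
  apply: fin_bigcap_measurable => //.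
  by move=> i _; rewrite -[_ @^-1` _]setTI; apply: measurable_funP.
move=> /= /andP[ks us].
pose upd B i := if i == k then B else A i.
pose G w := (\prod_(i <- s) f i (X i w)
             * \prod_(i | i \notin k :: s) \1_(A i) (X i w))%R.
have prodD (g : I -> R) : (\prod_(i | i \notin s) g i
    = g k * \prod_(i | i \notin k :: s) g i)%R.
  rewrite (bigD1 k)//=; congr (_ * _)%R; apply: eq_bigl => i.
  by rewrite in_cons negb_or andbC.
have updA B (g : I -> set R -> R) :
    (\prod_(i | i \notin k :: s) g i (upd B i)
     = \prod_(i | i \notin k :: s) g i (A i))%R.
  apply: eq_bigr => i; rewrite in_cons negb_or => /andP[/negbTE ik _].
  by rewrite /upd ik.
have GB B : measurable B -> \int[P]_w (G w * \1_B (X k w))%:E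
   = (\prod_(i <- s) m i * (fine (P (X k @^-1` B))
      * \prod_(i | i \notin k :: s) fine (P (X i @^-1` A i))))%:E.
  move=> mB; have := IH (upd B); rewrite prodD {3}/upd eqxx.
  rewrite (updA B (fun i B => fine (P (X i @^-1` B)))) => <-//; last first.
    by move=> i; rewrite /upd; case: ifP.
  apply: eq_integral => w _; rewrite prodD {1}/upd eqxx.
  rewrite (updA B (fun i B => \1_B (X i w) : R)).
  by congr _%:E; rewrite /G; ring.
have G0 w : (0 <= G w)%R by rewrite /G mulr_ge0// prodr_ge0.
have intG : \int[P]_w (G w)%:E = (\prod_(i <- s) m i
      * \prod_(i | i \notin k :: s) fine (P (X i @^-1` A i)))%:E.
  have := GB setT measurableT.
  rewrite preimage_setT probability_setT/= mul1r => <-.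
  by apply: eq_integral => w _; rewrite indicT mulr1.
transitivity (\int[P]_w (G w * f k (X k w))%:E).
  apply: eq_integral => w _; rewrite big_cons /G.
  by congr _%:E; ring.
have mXA i B : measurable B -> measurable (X i @^-1` B).
  by move=> mB; rewrite -[_ @^-1` _]setTI; apply: measurable_funP.
pose c := (\prod_(i <- s) m i
  * \prod_(i | i \notin k :: s) fine (P (X i @^-1` A i)))%R.
rewrite (integral_density (nu := distribution P (X k)) (c := c))//.
- rewrite ge0_integral_distribution//; last 2 first.
  - exact/measurable_EFinP.
  - by move=> x; rewrite lee_fin.
  by rewrite fm -EFinM big_cons; congr _%:E; rewrite /c; ring.
- apply: measurable_funM.
    apply: measurable_prod => i _.
    by apply: measurableT_comp => //; exact: measurable_funP.
  rewrite (_ : (fun w => _) = (fun w =>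
    (\prod_(i <- [seq i <- index_enum I | i \notin k :: s])
      \1_(A i) (X i w))%R)); last first.
    by apply/funext => w; rewrite big_filter.
  apply: measurable_prod => i _.
  by apply: (measurableT_comp (f := \1_(A i) : R -> R)).
- by rewrite -lee_fin /c -intG; apply: integral_ge0 => w _; rewrite lee_fin.
- move=> B mB; rewrite GB//.
  have pB : P (X k @^-1` B) = (fine (P (X k @^-1` B)))%:E.
    by rewrite fineK// fin_num_measure//; exact: mXA.
  transitivity (c%:E * P (X k @^-1` B)); last by [].
  by rewrite [in RHS]pB -EFinM; congr _%:E; rewrite /c; ring.
Qed.

Lemma integral_prod_indep (disp : measure_display)
    (T : measurableType disp) (R : realType) (P : probability T R) (I : finType)
    (X : I -> {RV P >-> R}) (f : I -> R -> R) (m : I -> R) :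
  mutually_independent X ->
  (forall i, measurable_fun [set: R] (f i)) -> (forall i x, (0 <= f i x)%R) ->
  (forall i, \int[P]_w (f i (X i w))%:E = (m i)%:E) ->
  \int[P]_w (\prod_i f i (X i w))%:E = (\prod_i m i)%:E.
Proof.
move=> indX mf f0 fm.
have := integral_prod_indep_partial (A := fun=> setT) indX mf f0 fm
  (fun=> measurableT) (index_enum_uniq I).
have none i : i \notin index_enum I = false by rewrite mem_index_enum.
move=> /esym; rewrite [X in (_ * X)%:E](eq_bigl xpred0)//.
rewrite big_pred0_eq mulr1 => ->.
apply: eq_integral => w _.
by rewrite [X in (_ * X)%R](eq_bigl xpred0)// big_pred0_eq mulr1.
Qed.

End independent_products.

(** * Gaussian linear combinations *)

Section gaussian.
Local Open Scope ereal_scope.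

(** Completing the square: tilting a centred Gaussian density by an exponential
    shifts its mean, which reduces the moment generating function to the total
    mass of a shifted density. *)
Lemma normal_fun_exp (R : realType) (s a x : R) : s != 0%R ->
  (expR (a * x) * normal_pdf 0 s x
   = expR (a ^+ 2 * s ^+ 2 / 2) * normal_pdf (a * s ^+ 2) s x)%R.
Proof.
move=> s0; rewrite !normal_pdfE// mulrCA [RHS]mulrCA; congr (_ * _)%R.
rewrite /normal_fun -!expRD; congr expR.
by field; rewrite s0.
Qed.

Lemma normal_mgf (R : realType) (nu : {measure set R -> \bar R}) (s a : R) :
  s != 0%R -> (forall A : set R, measurable A -> nu A = normal_prob 0 s A) ->
  \int[nu]_x (expR (a * x))%:E = (expR (a ^+ 2 * s ^+ 2 / 2))%:E.
Proof.
move=> s0 nuE.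
have mexp : measurable_fun [set: R] (fun x => expR (a * x)).
  by apply: measurableT_comp => //; apply: measurable_funM.
have density (A : set R) : measurable A ->
    \int[lebesgue_measure]_x (normal_pdf 0 s x * \1_A (idfun x))%:E
    = 1%:E * nu A.
  move=> mA; rewrite mul1e nuE// /normal_prob [RHS]integral_mkcond.
  apply: eq_integral => x _; rewrite patchE indicE /=.
  by case: ifP => _; rewrite ?mulr1 ?mulr0.
have exp0 x : (0 <= expR (a * x))%R by exact: expR_ge0.
rewrite -[LHS]mul1e -(integral_density (mu := lebesgue_measure)
  (nu := nu) (measurable_normal_pdf 0 s)
  (normal_pdf_ge0 0 s) (@measurable_id _ _ _) ler01 mexp exp0 density).
transitivity (\int[lebesgue_measure]_x ((expR (a ^+ 2 * s ^+ 2 / 2))%:E *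
    (normal_pdf (a * s ^+ 2) s x)%:E)).
  by apply: eq_integral => x _; rewrite mulrC normal_fun_exp// EFinM.
rewrite ge0_integralZl//.
- by rewrite integral_normal_pdf mule1.
- by apply/measurable_EFinP; exact: measurable_normal_pdf.
- by move=> x _; rewrite lee_fin normal_pdf_ge0.
Qed.

End gaussian.

Section gaussian_tail.
Local Open Scope ereal_scope.
Context (disp : measure_display) (T : measurableType disp) (R : realType)
  (P : probability T R) (m : nat) (sigma : R) (eps : 'I_m -> {RV P >-> R}).

Lemma measurable_linear_comb (a : 'I_m -> R) :
  measurable_fun setT (fun w => \sum_v a v * eps v w)%R.
Proof.
apply: measurable_sum => v; apply: measurable_funM => //.
Qed.

Lemma gaussian_linear_mgf (a : 'I_m -> R) (r : R) :
  sigma != 0%R -> isotropic_gaussian sigma eps ->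
  \int[P]_w (expR (r * \sum_v a v * eps v w))%:E
  = (expR (r ^+ 2 * (sigma ^+ 2 * \sum_v a v ^+ 2) / 2))%:E.
Proof.
move=> s0 [ind law].
have mf v : measurable_fun [set: R] (fun x => expR (r * a v * x)).
  by apply: measurableT_comp => //; apply: measurable_funM.
have fm v : \int[P]_w (expR (r * a v * eps v w))%:E
    = (expR ((r * a v) ^+ 2 * sigma ^+ 2 / 2))%:E.
  transitivity (\int[distribution P (eps v)]_x (expR (r * a v * x))%:E).
    rewrite ge0_integral_distribution//.
    exact/measurable_EFinP.
  by apply: normal_mgf => // A mA; exact: law.
have := integral_prod_indep ind mf (fun v x => expR_ge0 (r * a v * x)) fm.
rewrite -expR_sum => H; transitivity (\int[P]_w
    (\prod_v expR (r * a v * eps v w))%:E).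
  apply: eq_integral => w _; rewrite -expR_sum; congr (expR _)%:E.
  by rewrite mulr_sumr; apply: eq_bigr => v _; rewrite mulrA.
rewrite H; congr (expR _)%:E; rewrite -mulr_suml; congr (_ / _)%R.
by rewrite !mulr_sumr; apply: eq_bigr => v _; rewrite exprMn; ring.
Qed.

(** Chernoff's bound at its optimal parameter t / V; [V] is only an upper bound of
    the variance, so that one threshold can serve all the edges. *)
Lemma gaussian_tail_upper (a : 'I_m -> R) (V t : R) :
  (0 < sigma)%R -> isotropic_gaussian sigma eps ->
  (0 < V)%R -> (sigma ^+ 2 * \sum_v a v ^+ 2 <= V)%R -> (0 < t)%R ->
  P [set w | (t <= \sum_v a v * eps v w)%R] <= (expR (- (t ^+ 2 / (2 * V))))%:E.
Proof.
move=> s0 gauss V0 aV t0.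
pose Z : {RV P >-> R} := mfun_Sub (mem_set (measurable_linear_comb a)).
have r0 : (0 < t / V)%R by rewrite divr_gt0.
have ZE w : Z w = (\sum_v a v * eps v w)%R by [].
have := chernoff Z t r0.
have -> : 'M_P Z (t / V)
    = (expR ((t / V) ^+ 2 * (sigma ^+ 2 * \sum_v a v ^+ 2) / 2))%:E.
  rewrite /mmt_gen_fun unlock -gaussian_linear_mgf ?gt_eqF//.
  by apply: eq_integral => w _ /=; rewrite mulrC.
move=> /le_trans; apply; rewrite -EFinM -expRD lee_fin ler_expR.
apply: (@le_trans _ _ ((t / V) ^+ 2 * V / 2 - t / V * t)%R).
  by rewrite lerD2r ler_pM2r ?invr_gt0// ler_wpM2l// sqr_ge0.
rewrite le_eqVlt; apply/orP; left; apply/eqP; field.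
by rewrite gt_eqF.
Qed.

Lemma measurable_linear_tail (a : 'I_m -> R) (t : R) :
  measurable [set w | (t <= `|\sum_v a v * eps v w|)%R].
Proof.
rewrite -[X in measurable X]setTI; apply: (measurable_fun_le (f := cst t)) => //.
by apply: measurableT_comp => //; exact: measurable_linear_comb.
Qed.

Lemma gaussian_tail (a : 'I_m -> R) (V t : R) :
  (0 < sigma)%R -> isotropic_gaussian sigma eps ->
  (0 < V)%R -> (sigma ^+ 2 * \sum_v a v ^+ 2 <= V)%R -> (0 < t)%R ->
  P [set w | (t <= `|\sum_v a v * eps v w|)%R]
  <= (2 * expR (- (t ^+ 2 / (2 * V))))%:E.
Proof.
move=> s0 gauss V0 aV t0.
have mge b : measurable [set w | (t <= \sum_v b v * eps v w)%R].
  rewrite -[X in measurable X]setTI.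
  apply: (measurable_fun_le (f := cst t)) => //.
  exact: measurable_linear_comb.
have -> : [set w | (t <= `|\sum_v a v * eps v w|)%R]
    = [set w | (t <= \sum_v a v * eps v w)%R]
      `|` [set w | (t <= \sum_v (- a v) * eps v w)%R].
  have sN w : (\sum_v - a v * eps v w = - \sum_v a v * eps v w)%R.
    by rewrite -sumrN; apply: eq_bigr => v _; rewrite mulNr.
  apply/seteqP; split => w /=; rewrite sN ler_normr; first by move/orP.
  by move=> ?; apply/orP.
rewrite mulr_natl mulr2n EFinD.
have PU := @measureU2 _ _ _ P _ _ (mge a) (mge (fun v => - a v)%R).
apply: (le_trans PU); apply: leeD; apply: gaussian_tail_upper => //.
by under eq_bigr do rewrite sqrrN.
Qed.

End gaussian_tail.

(** * Discretised segments on one axis *)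

Lemma card_ord_interval (N lo len : nat) (A : {set 'I_N}) :
  (forall i, i \in A -> (lo <= i <= lo + len)%N) -> (#|A| <= len.+1)%N.
Proof.
move=> Alo; pose f (i : 'I_N) : 'I_len.+1 := inord (i - lo).
rewrite -(@card_in_imset _ _ f A).
  by rewrite -[X in (_ <= X)%N]card_ord; exact: max_card.
move=> i j /Alo /andP[i1 i2] /Alo /andP[j1 j2] /(congr1 val) /=.
by rewrite !inordK ?ltnS ?leq_subLR// => ij; apply: val_inj => /=; lia.
Qed.

Lemma card_ord_spread (N len : nat) (A : {set 'I_N}) :
  (forall i j, i \in A -> j \in A -> (i <= j -> j <= i + len)%N) ->
  (#|A| <= len.+1)%N.
Proof.
move=> Alen; have [->|[i0 Ai0]] := set_0Vmem A; first by rewrite cards0.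
case: (arg_minnP (fun i : 'I_N => i : nat) Ai0) => i Ai imin.
apply: (@card_ord_interval _ i) => j Aj.
by rewrite imin//= Alen// imin.
Qed.

(** The whole convex combination is rounded down: positions then stay below N,
    reach the target exactly at time N and move by at most one per unit of
    time. *)
Definition interp (N t a b : nat) : nat := (((N - t) * a + t * b) %/ N)%N.

Definition within_one (x y : nat) : bool := (x <= y.+1)%N && (y <= x.+1)%N.

Section interp.
Context (N : nat).
Implicit Types a b c : 'I_N.

Lemma interp_ltn t a b : (t <= N)%N -> (interp N t a b < N)%N.
Proof.
move=> tN; have a_lt := ltn_ord a; have b_lt := ltn_ord b.
rewrite /interp ltn_divLR; last by lia.
have : ((N - t) * a <= (N - t) * N.-1)%N by rewrite leq_mul2l; lia.
have : (t * b <= t * N.-1)%N by rewrite leq_mul2l; lia.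
nia.
Qed.

Lemma interp_start a b : interp N 0 a b = a.
Proof. by rewrite /interp subn0 addn0 mulKn//; have := ltn_ord a; lia. Qed.

Lemma interp_end a b : interp N N a b = b.
Proof. by rewrite /interp subnn mulKn//; have := ltn_ord a; lia. Qed.

(** Numerators of consecutive positions differ by |a - b| < N. *)
Lemma interp_step t a b : (t < N)%N -> within_one (interp N t.+1 a b) (interp N t a b).
Proof.
move=> tN; have a_lt := ltn_ord a; have b_lt := ltn_ord b.
have N0 : (0 < N)%N by lia.
rewrite /interp /within_one; set x := ((N - t) * a + t * b)%N.
set y := ((N - t.+1) * a + t.+1 * b)%N.
have xy : (y + a = x + b)%N by rewrite /x /y; nia.
have yx : (y <= x + N)%N by lia.
have xy' : (x <= y + N)%N by lia.
have div_le u v : (u <= v + N)%N -> (u %/ N <= (v %/ N).+1)%N.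
  by move=> uv; rewrite (leq_trans (leq_div2r N uv))// divnDr// divnn N0 addn1.
by rewrite !div_le.
Qed.

(** Being within one of c, written without the division so that the two counts
    below are linear arithmetic. *)
Lemma within_one_interp_bounds t a b c : (t <= N)%N -> within_one (interp N t a b) c ->
  (N * c <= (N - t) * a + t * b + N)%N /\
  ((N - t) * a + t * b < N * c.+2)%N.
Proof.
move=> tN /andP[h1 h2]; have N0 : (0 < N)%N by have := ltn_ord c; lia.
split.
  have : (N * c <= N * (interp N t a b).+1)%N by rewrite leq_mul2l h2 orbT.
  move=> /leq_trans; apply; rewrite mulnSr leq_add2r mulnC; exact: leq_trunc_div.
by rewrite [(N * c.+2)%N]mulnC -ltn_divLR.
Qed.

(** Spreading: at time t the position moves by about t / N when the target moves
    by 1, so O(N / t) targets lead to a given place. *)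
Lemma within_one_interp_target t a c : (t < N)%N ->
  (#|[set b : 'I_N | within_one (interp N t a b) c]%SET| * t.+1 <= 8 * N)%N.
Proof.
move=> tN; have N0 : (0 < N)%N by lia.
have [->|t0] := posnP t.
  by rewrite muln1 (leq_trans (max_card _))// card_ord; lia.
set A := [set _ | _]%SET.
have : (#|A| <= (3 * N %/ t).+1)%N.
  apply: card_ord_spread => b b'; rewrite !finset.inE.
  move=> /(within_one_interp_bounds (ltnW tN))[h1 h2].
  move=> /(within_one_interp_bounds (ltnW tN))[h3 h4] bb'.
  rewrite -leq_subLR leq_divRL// mulnC mulnBr; lia.
move=> h; have := leq_mul h (leqnn t); rewrite mulSn.
have := leq_trunc_div (3 * N) t; nia.
Qed.

(** Finite speed: a traveller near c at time t started within O(t) of c. *)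
Lemma within_one_interp_source t c : (t < N)%N ->
  (#|[set a : 'I_N | [exists b : 'I_N, within_one (interp N t a b) c]]%SET|
   <= 3 * t.+1)%N.
Proof.
move=> tN; apply: (@leq_trans (2 * t + 2).+1); last lia.
apply: (@card_ord_interval _ (c - t.+1)) => a; rewrite finset.inE.
move=> /existsP[b] /(within_one_interp_bounds (ltnW tN))[h1 h2].
have a_lt := ltn_ord a; have b_lt := ltn_ord b.
have e1 : ((N - t) * a = N * a - t * a)%N by rewrite mulnBl.
have e2 : (t * a <= N * a)%N by rewrite leq_mul2r (ltnW tN) orbT.
have tb : (t * b <= N * t)%N by rewrite mulnC leq_mul2r (ltnW b_lt) orbT.
have ta : (t * a <= N * t)%N by rewrite mulnC leq_mul2r (ltnW a_lt) orbT.
have N0 : (0 < N)%N by lia.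
have lo : (c <= a + t + 1)%N by rewrite -(leq_pmul2l N0) !mulnDr muln1; lia.
have hi : (a < t + c.+2)%N by rewrite -(ltn_pmul2l N0) mulnDr; lia.
by apply/andP; split; lia.
Qed.

End interp.

(** * Lattice paths *)

Section grid_paths.
Context (N d : nat).
Implicit Types v w x y : grid N d.

(** All coordinates follow [interp] simultaneously; to stay on grid edges, the
    step from time t to t + 1 is cut into d moves, the first j coordinates
    having already moved at stage j.  For t < N the positions are below N, so
    that the default value of [insubd] never occurs. *)
Definition path_point v w (t j : nat) : grid N d :=
  [ffun k : 'I_d =>
    insubd (v k) (interp N (if (k < j)%N then t.+1 else t) (v k) (w k))].

Lemma path_pointE v w t j k : (t < N)%N ->
  path_point v w t j k
  = interp N (if (k < j)%N then t.+1 else t) (v k) (w k) :> nat.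
Proof.
by move=> tN; rewrite ffunE val_insubd interp_ltn//; case: ifP => // _; exact: ltnW.
Qed.

Lemma path_point_start v w : path_point v w 0 0 = v.
Proof.
by apply/ffunP => k; apply: val_inj; rewrite ffunE val_insubd interp_start ltn_ord.
Qed.

Lemma path_point_end v w : path_point v w N 0 = w.
Proof.
by apply/ffunP => k; apply: val_inj; rewrite ffunE val_insubd interp_end ltn_ord.
Qed.

Lemma path_point_next v w t : path_point v w t d = path_point v w t.+1 0.
Proof. by apply/ffunP => k; rewrite !ffunE ltn_ord. Qed.

(** A move may be trivial, whence the equality. *)
Definition adjacent x y := [|| x == y, grid_step x y | grid_step y x].

Lemma path_point_adjacent v w t j : (t < N)%N -> (j < d)%N ->
  adjacent (path_point v w t j) (path_point v w t j.+1).
Proof.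
move=> tN jd; set x := path_point v w t j; set y := path_point v w t j.+1.
pose k := Ordinal jd.
have off l : l != k -> x l = y l :> nat.
  move=> lk; rewrite !path_pointE//; congr (interp N _ _ _).
  have : l != j :> nat by apply: contra lk => /eqP lj; apply/eqP/val_inj.
  by rewrite ltnS [(l <= j)%N]leq_eqVlt => /negbTE ->.
have xk : x k = interp N t (v k) (w k) :> nat by rewrite path_pointE// ltnn.
have yk : y k = interp N t.+1 (v k) (w k) :> nat.
  by rewrite path_pointE//= ltnSn.
have := interp_step (v k) (w k) tN; rewrite -xk -yk => /andP[h1 h2].
have offb (a b : grid N d) : (forall l, l != k -> a l = b l :> nat) ->
    [forall l, (l != k) ==> (a l == b l)].
  by move=> ab; apply/forallP => l; apply/implyP => /ab e; apply/eqP/val_inj.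
rewrite /adjacent; case: (ltngtP (x k) (y k)) => xy.
- apply/or3P/Or32/existsP; exists k; rewrite offb ?andbT; last first.
    by move=> l /off.
  by apply/eqP; lia.
- apply/or3P/Or33/existsP; exists k; rewrite offb ?andbT//.
  by apply/eqP; lia.
- apply/or3P/Or31/eqP/ffunP => l; apply: val_inj.
  by have [->|/off] := eqVneq l k.
Qed.

Lemma within_one_path_point v w t j k : (t < N)%N ->
  within_one (interp N t (v k) (w k)) (path_point v w t j k).
Proof.
move=> tN; rewrite path_pointE//; case: ifP => _.
  by have := interp_step (v k) (w k) tN; rewrite /within_one andbC.
by rewrite /within_one leqnSn.
Qed.

End grid_paths.

(** * The flow and its energy *)

Section flow.
Context (R : realType) (N d : nat).
Implicit Types (v w x y : grid N d) (e : grid N d * grid N d) (D : grid N d -> R).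

Definition traversal x y e : R := ((x, y) == e)%:R - ((y, x) == e)%:R.

Lemma grid_step_asym x y : grid_step x y -> ~~ grid_step y x.
Proof.
move=> /existsP[k /andP[/eqP xy /forallP off]]; apply/negP => /existsP[l].
move=> /andP[/eqP yx _].
have [lk|lk] := eqVneq l k; first by move: yx xy; rewrite lk; lia.
by have /implyP/(_ lk)/eqP := off l => e; rewrite -e in yx; lia.
Qed.

Lemma sum_edge_indicator D x y :
  \sum_(e in grid_edges N d) ((x, y) == e)%:R * (D e.1 - D e.2)
  = (grid_step x y)%:R * (D x - D y).
Proof.
have [xy|xy] := boolP (grid_step x y).
  rewrite (bigD1 (x, y)) ?finset.inE//= eqxx big1 ?addr0// => e /andP[_ ne].
  by rewrite eq_sym (negbTE ne) mul0r.
rewrite mul0r big1// => e; rewrite finset.inE.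
by have [<-|] := eqVneq (x, y) e; rewrite ?mul0r//= (negbTE xy).
Qed.

Lemma sum_traversal D x y : adjacent x y ->
  \sum_(e in grid_edges N d) traversal x y e * (D e.1 - D e.2) = D x - D y.
Proof.
under eq_bigr do rewrite mulrBl.
rewrite sumrB !sum_edge_indicator => /or3P[/eqP ->|xy|yx].
- by rewrite !subrr.
- by rewrite xy (negbTE (grid_step_asym xy)) mul1r mul0r subr0.
- by rewrite yx (negbTE (grid_step_asym yx)) mul1r mul0r sub0r opprB.
Qed.

Definition flow e v : R :=
  (N ^ d)%:R^-1 * \sum_(w : grid N d) \sum_(t < N) \sum_(j < d)
    traversal (path_point v w t j) (path_point v w t j.+1) e.

Lemma path_telescope D v w :
  \sum_(t < N) \sum_(j < d)
    (D (path_point v w t j) - D (path_point v w t j.+1)) = D v - D w.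
Proof.
have inner t : \sum_(j < d)
    (D (path_point v w t j) - D (path_point v w t j.+1))
    = D (path_point v w t 0) - D (path_point v w t.+1 0).
  rewrite -path_point_next -(big_mkord xpredT (fun j =>
    D (path_point v w t j) - D (path_point v w t j.+1))).
  rewrite -[RHS]opprB -(telescope_sumr (fun j => D (path_point v w t j)) (leq0n d)).
  by rewrite -sumrN; apply: eq_bigr => j _; rewrite opprB.
under eq_bigr do rewrite inner.
rewrite -(big_mkord xpredT (fun t =>
  D (path_point v w t 0) - D (path_point v w t.+1 0))).
rewrite -[in RHS](path_point_start v w) -[in X in _ = _ - X](path_point_end v w).
rewrite -[RHS]opprB -(telescope_sumr (fun t => D (path_point v w t 0)) (leq0n N)).
by rewrite -sumrN; apply: eq_bigr => j _; rewrite opprB.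
Qed.

Lemma card_grid : #|{: grid N d}| = (N ^ d)%N.
Proof. by rewrite card_ffun !card_ord. Qed.

(** The flow inverts the gradient up to constants: the path from v to w
    telescopes to D v - D w, and averaging over w subtracts the mean. *)
Lemma flow_divergence D v : (0 < N)%N ->
  \sum_(e in grid_edges N d) flow e v * (D e.1 - D e.2)
  = D v - (N ^ d)%:R^-1 * \sum_w D w.
Proof.
move=> N0; have n0 : (N ^ d)%:R != 0 :> R by rewrite pnatr_eq0 expn_eq0; lia.
transitivity ((N ^ d)%:R^-1 * \sum_(w : grid N d) (D v - D w)); last first.
  by rewrite sumrB sumr_const card_grid -[D v *+ _]mulr_natl mulrBr mulKf.
rewrite /flow; under eq_bigr do rewrite -mulrA mulr_suml.
rewrite -mulr_sumr exchange_big/=; congr (_ * _); apply: eq_bigr => w _.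
rewrite -path_telescope; under eq_bigr do rewrite mulr_suml.
rewrite exchange_big/=; apply: eq_bigr => t _.
under eq_bigr do rewrite mulr_suml.
rewrite exchange_big/=; apply: eq_bigr => j _.
by rewrite sum_traversal// path_point_adjacent.
Qed.

Definition visit_freq (t : nat) (a c : 'I_N) : R :=
  N%:R^-1 * \sum_(b < N) (within_one (interp N t a b) c)%:R.

Lemma visit_freq_ge0 t a c : 0 <= visit_freq t a c.
Proof. by rewrite mulr_ge0 ?invr_ge0// sumr_ge0. Qed.

(** A path using e at time t has all its coordinates within one of those of e.1.
    The targets w being the points of a product set, the proportion of them
    satisfying this is the product of the proportions on each axis. *)
Lemma norm_flow_le e v :
  `|flow e v| <= \sum_(t < N) d%:R * \prod_(k < d) visit_freq t (v k) (e.1 k).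
Proof.
have -> : \sum_(t < N) d%:R * \prod_(k < d) visit_freq t (v k) (e.1 k)
    = (N ^ d)%:R^-1 * \sum_(w : grid N d) \sum_(t < N)
        d%:R * \prod_(k < d) (within_one (interp N t (v k) (w k)) (e.1 k))%:R.
  rewrite exchange_big/= mulr_sumr; apply: eq_bigr => t _.
  rewrite -mulr_sumr mulrCA; congr (_ * _).
  rewrite big_split/= prodr_const card_ord natrX exprVn; congr (_ * _).
  by rewrite bigA_distr_bigA.
rewrite normrM ger0_norm ?invr_ge0// ler_wpM2l ?invr_ge0//.
apply: le_trans (ler_norm_sum _ _ _) _; apply: ler_sum => w _.
apply: le_trans (ler_norm_sum _ _ _) _; apply: ler_sum => t _.
apply: le_trans (ler_norm_sum _ _ _) _.
set p := \prod_(k < d) _.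
apply: (@le_trans _ _ (\sum_(j < d) p)); last first.
  by rewrite sumr_const card_ord mulr_natl.
apply: ler_sum => j _; rewrite /traversal.
have p0 : 0 <= p by rewrite /p prodr_ge0.
have p1 i : path_point v w t i = e.1 -> p = 1.
  by move=> vi; rewrite /p big1// => k _; rewrite -vi within_one_path_point.
have [xy|_] := eqVneq (_, _) e; have [yx|_] := eqVneq (_, _) e.
- by rewrite subrr normr0.
- by rewrite subr0 normr1 (p1 j)// -xy.
- by rewrite sub0r normrN1 (p1 j.+1)// -yx.
- by rewrite subrr normr0.
Qed.

Lemma visit_freq_le t a c : (t < N)%N -> visit_freq t a c <= 8 / t.+1%:R.
Proof.
move=> tN; have N0 : 0 < N%:R :> R by rewrite ltr0n; lia.
rewrite /visit_freq ler_pdivlMr ?ltr0n// mulrAC -mulrA ler_pdivrMl//.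
have -> : \sum_(b < N) (within_one (interp N t a b) c)%:R
    = #|[set b : 'I_N | within_one (interp N t a b) c]%SET|%:R :> R.
  rewrite -sum1_card natr_sum [RHS]big_mkcond/=; apply: eq_bigr => b _.
  by rewrite finset.inE; case: ifP.
by rewrite -natrM mulrC -natrM ler_nat mulnC within_one_interp_target.
Qed.

Lemma sum_visit_freq_le t c : (t < N)%N -> \sum_a visit_freq t a c <= 24.
Proof.
move=> tN.
pose S := [set a : 'I_N | [exists b : 'I_N, within_one (interp N t a b) c]]%SET.
have t0 : 0 < t.+1%:R :> R by rewrite ltr0n.
rewrite (bigID [in S])/= [X in _ + X]big1 ?addr0; last first.
  move=> a; rewrite finset.inE => /existsPn na.
  by rewrite /visit_freq big1 ?mulr0// => b _; rewrite (negbTE (na b)).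
apply: (@le_trans _ _ (\sum_(a in S) 8 / t.+1%:R)).
  by apply: ler_sum => a _; exact: visit_freq_le.
rewrite sumr_const -[(8 / _) *+ _]mulr_natl mulrA ler_pdivrMr// -!natrM ler_nat.
have := within_one_interp_source c tN; rewrite -/S; lia.
Qed.

(** Each unordered pair of times is charged to its larger element. *)
Lemma sqr_sum_le (n : nat) (b : nat -> R) : (forall t, 0 <= b t) ->
  (\sum_(t < n) b t) ^+ 2 <= 2 * \sum_(s < n) b s * \sum_(t < s.+1) b t.
Proof.
move=> b0; elim: n => [|n IH]; first by rewrite !big_ord0 expr0n mulr0.
rewrite [X in X ^+ 2]big_ord_recr [in leRHS]big_ord_recr/= [in leRHS]big_ord_recr/=.
have := b0 n; nra.
Qed.

Definition visit_bound t v (c : grid N d) : R :=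
  d%:R * \prod_(k < d) visit_freq t (v k) (c k).

Lemma visit_bound_ge0 t v c : 0 <= visit_bound t v c.
Proof.
by rewrite mulr_ge0// prodr_ge0// => k _; exact: visit_freq_ge0.
Qed.

Lemma visit_bound_le s v c : (s < N)%N ->
  visit_bound s v c <= d%:R * (8 / s.+1%:R) ^+ d.
Proof.
move=> sN; rewrite ler_wpM2l// -[d in leRHS]card_ord -prodr_const.
by apply: ler_prod => k _; rewrite visit_freq_ge0 visit_freq_le.
Qed.

Lemma sum_visit_bound_le t c : (t < N)%N ->
  \sum_(v : grid N d) visit_bound t v c <= d%:R * 24 ^+ d.
Proof.
move=> tN; rewrite -mulr_sumr ler_wpM2l// -[d in leRHS]card_ord -prodr_const.
rewrite -(bigA_distr_bigA (fun k a => visit_freq t a (c k))).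
apply: ler_prod => k _; rewrite sum_visit_freq_le// andbT.
by apply: sumr_ge0 => a _; exact: visit_freq_ge0.
Qed.

(** For times t <= s, the bound (8 / (s + 1))^d is used at the later time and the
    sum over v, at most a constant, at the earlier one: this loses
    nothing, whereas a triangle inequality in l^2 over the times would cost an
    extra logarithm when d = 2. *)
Lemma flow_energy_sum e : (0 < d)%N ->
  \sum_(v : grid N d) flow e v ^+ 2
  <= 2 * d%:R ^+ 2 * 192 ^+ d * \sum_(s < N) s.+1%:R ^- d.-1.
Proof.
move=> d0.
pose b t v := visit_bound t v e.1.
apply: (@le_trans _ _ (\sum_(v : grid N d) 2 *
    \sum_(s < N) b s v * \sum_(t < s.+1) b t v)).
  apply: ler_sum => v _; apply: le_trans (sqr_sum_le N (fun t => visit_bound_ge0 t v e.1)).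
  rewrite -real_normK ?num_real// ler_sqr ?nnegrE ?sumr_ge0//.
    exact: norm_flow_le.
  by move=> t _; exact: visit_bound_ge0.
rewrite -mulr_sumr -!mulrA ler_wpM2l// exchange_big/= !mulr_sumr.
apply: ler_sum => s _.
apply: (@le_trans _ _ (\sum_(v : grid N d) (d%:R * (8 / s.+1%:R) ^+ d)
    * \sum_(t < s.+1) b t v)).
  apply: ler_sum => v _; rewrite ler_wpM2r ?visit_bound_le//.
  by apply: sumr_ge0 => t _; exact: visit_bound_ge0.
rewrite -mulr_sumr exchange_big/=.
apply: (@le_trans _ _ ((d%:R * (8 / s.+1%:R) ^+ d)
    * \sum_(t < s.+1) (d%:R * 24 ^+ d))).
  rewrite ler_wpM2l ?mulr_ge0 ?exprn_ge0 ?divr_ge0//.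
  apply: ler_sum => t _; apply: sum_visit_bound_le.
  by rewrite (leq_ltn_trans _ (ltn_ord s))// -ltnS.
rewrite sumr_const card_ord -[(_ * _) *+ s.+1]mulr_natr expr_div_n.
have s0 : s.+1%:R != 0 :> R by rewrite pnatr_eq0.
rewrite le_eqVlt; apply/orP; left; apply/eqP.
have -> : (192 : R) = 8 * 24 by rewrite -natrM.
have -> : s.+1%:R ^+ d = s.+1%:R * s.+1%:R ^+ d.-1 :> R.
  by rewrite -exprS prednK.
rewrite exprMn; move: (s.+1%:R : R) s0 => x x0.
have y0 : x ^+ d.-1 != 0 by rewrite expf_neq0.
move: (x ^+ d.-1) (8 ^+ d : R) (24 ^+ d : R) y0 => y p q y0.
by field; rewrite y0 x0.
Qed.

End flow.

(** * Growth of the energy *)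

Section harmonic.
Context (R : realType).

Lemma ln_le_subr1 (x : R) : 0 < x -> ln x <= x - 1.
Proof. by move=> x0; rewrite -{1}(subrKC 1 x) le_ln1Dx// ltrBrDr addNr. Qed.

Lemma harmonic_sum_le_ln (N : nat) :
  \sum_(s < N.+1) s.+1%:R^-1 <= 1 + ln N.+1%:R :> R.
Proof.
elim: N => [|N IH]; first by rewrite big_ord1 invr1 ln1 addr0.
rewrite big_ord_recr/=.
have N1 : 0 < N.+1%:R :> R by rewrite ltr0n.
have N2 : 0 < N.+2%:R :> R by rewrite ltr0n.
have : ln (N.+1%:R / N.+2%:R) <= N.+1%:R / N.+2%:R - 1 :> R.
  by apply: ln_le_subr1; rewrite divr_gt0.
rewrite ln_div ?posrE// => h.
have e : N.+1%:R / N.+2%:R - 1 = - N.+2%:R^-1 :> R.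
  rewrite -[N.+2%:R]natr1; move: (N.+1%:R : R) N1 => x x0.
  by field; rewrite gt_eqF//; lra.
rewrite e in h; apply: (le_trans (lerD IH (lexx _))); move: h.
by move: (ln _) (ln _) (_^-1) => a b c; lra.
Qed.

Lemma inverse_square_sum_le (N : nat) :
  \sum_(s < N.+1) s.+1%:R ^- 2 <= 2 - N.+1%:R^-1 :> R.
Proof.
elim: N => [|N IH]; first by rewrite big_ord1 expr1n invr1; lra.
rewrite big_ord_recr/=; apply: (le_trans (lerD IH (lexx _))).
rewrite -subr_ge0.
have -> : 2 - N.+2%:R^-1 - (2 - N.+1%:R^-1 + N.+2%:R ^- 2)
    = (N.+1%:R * N.+2%:R ^+ 2)^-1 :> R.
  have : 0 < N.+1%:R :> R by rewrite ltr0n.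
  rewrite -[N.+2%:R]natr1; move: (N.+1%:R : R) => x x0.
  by field; rewrite !gt_eqF//; lra.
by rewrite invr_ge0 mulr_ge0// exprn_ge0.
Qed.

Lemma power_sum_le_rfactor (N d : nat) : (2 <= d)%N -> (2 <= N)%N ->
  \sum_(s < N) s.+1%:R ^- d.-1 <= 2 * rfactor R d (N ^ d).
Proof.
move=> d2 N2; case: N N2 => [//|N] N2; rewrite /rfactor.
case: eqP => [->|dn2].
  apply: (le_trans (harmonic_sum_le_ln N)).
  rewrite natrX lnXn ?ltr0n// mulr2n.
  have : ln 2 <= ln N.+1%:R :> R by rewrite ler_ln ?posrE ?ltr0n// ler_nat.
  have : 1 / 2 <= ln 2 :> R.
    have := @ln_le_subr1 2^-1; rewrite lnV ?posrE//; lra.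
  by move: (ln _) (ln _) => a b; lra.
apply: (@le_trans _ _ (\sum_(s < N.+1) s.+1%:R ^- 2)).
  apply: ler_sum => s _.
  rewrite lef_pV2 ?posrE ?exprn_gt0 ?ltr0n//.
  by rewrite ler_weXn2l ?ler1n//; lia.
apply: (le_trans (inverse_square_sum_le N)).
by rewrite mulr1 lerBlDr lerDl invr_ge0.
Qed.

End harmonic.

(** * Degrees of the grid *)

Section grid_degree.
Context (N d : nat).
Implicit Types x y : grid N d.

Lemma card_successors_le x : (#|[set y | grid_step x y]%SET| <= d)%N.
Proof.
pose up (k : 'I_d) : grid N d :=
  [ffun l => if l == k then insubd (x l) (x l).+1 else x l].
have sub : [set y | grid_step x y]%SET \subset [set up k | k in 'I_d]%SET.
  apply/fintype.subsetP => y; rewrite finset.inE => /existsP[k /andP[/eqP yk /forallP off]].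
  apply/imsetP; exists k => //; apply/ffunP => l; apply: val_inj; rewrite ffunE.
  have [->|lk] := eqVneq l k; first by rewrite val_insubd -yk ltn_ord.
  by have /implyP/(_ lk)/eqP := off l => ->.
apply: (leq_trans (subset_leq_card sub)).
by rewrite (leq_trans (leq_imset_card _ _))// card_ord.
Qed.

Lemma card_predecessors_le y : (#|[set x | grid_step x y]%SET| <= d)%N.
Proof.
pose down (k : 'I_d) : grid N d :=
  [ffun l => if l == k then insubd (y l) (y l).-1 else y l].
have sub : [set x | grid_step x y]%SET \subset [set down k | k in 'I_d]%SET.
  apply/fintype.subsetP => x; rewrite finset.inE => /existsP[k /andP[/eqP yk /forallP off]].
  apply/imsetP; exists k => //; apply/ffunP => l; apply: val_inj; rewrite ffunE.
  have [->|lk] := eqVneq l k; first by rewrite val_insubd yk /= ltn_ord.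
  by have /implyP/(_ lk)/eqP := off l => ->.
apply: (leq_trans (subset_leq_card sub)).
by rewrite (leq_trans (leq_imset_card _ _))// card_ord.
Qed.

Lemma sum_edges_pair (R : realType) (F : grid N d * grid N d -> R) :
  \sum_(e in grid_edges N d) F e = \sum_x \sum_(y | grid_step x y) F (x, y).
Proof.
rewrite pair_big_dep/=; apply: eq_big => [e|[x y] _ //].
by rewrite finset.inE.
Qed.

Lemma sum_edges_tail_le (R : realType) (F : grid N d -> R) :
  (forall x, 0 <= F x) ->
  \sum_(e in grid_edges N d) F e.1 <= d%:R * \sum_x F x.
Proof.
move=> F0; rewrite sum_edges_pair mulr_sumr; apply: ler_sum => x _ /=.
rewrite sumr_const mulr_natl ler_wpMn2l//.
by rewrite -[X in (X <= _)%N]cardsE card_successors_le.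
Qed.

Lemma sum_edges_head_le (R : realType) (F : grid N d -> R) :
  (forall x, 0 <= F x) ->
  \sum_(e in grid_edges N d) F e.2 <= d%:R * \sum_x F x.
Proof.
move=> F0; rewrite sum_edges_pair (exchange_big_dep xpredT)//= mulr_sumr.
apply: ler_sum => y _; rewrite sumr_const mulr_natl ler_wpMn2l//.
by rewrite -[X in (X <= _)%N]cardsE card_predecessors_le.
Qed.

Lemma card_grid_edges_le : (#|grid_edges N d| <= d * N ^ d)%N.
Proof.
rewrite -sum1_card -card_grid -sum1_card big_distrr/=.
rewrite (eq_bigl (fun e : grid N d * grid N d => grid_step e.1 e.2)); last first.
  by move=> e; rewrite finset.inE.
rewrite -(pair_big_dep xpredT (@grid_step N d) (fun _ _ => 1%N))/=.
apply: leq_sum => x _; rewrite sum1_card muln1 -[X in (X <= _)%N]cardsE.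
exact: card_successors_le.
Qed.

End grid_degree.

(** * The oracle inequality *)

Section oracle.
Context (R : realType).

Lemma sqr_sum_le_card (I : finType) (F : I -> R) :
  (\sum_i F i) ^+ 2 <= #|I|%:R * \sum_i F i ^+ 2.
Proof.
have [I0|I0] := posnP #|I|.
  rewrite big1; last by move=> i _; move/card0_eq/(_ i): I0.
  by rewrite expr0n/= mulr_ge0// sumr_ge0// => i _; exact: sqr_ge0.
have n0 : 0 < #|I|%:R :> R by rewrite ltr0n.
set n : R := #|I|%:R in n0 *; set s := \sum_i F i.
have : 0 <= \sum_i (F i * n - s) ^+ 2 by rewrite sumr_ge0// => i _; exact: sqr_ge0.
have -> : \sum_i (F i * n - s) ^+ 2
    = n * (n * \sum_i F i ^+ 2 - s ^+ 2).
  rewrite (eq_bigr (fun i => n ^+ 2 * F i ^+ 2 + (- (2 * n * s)) * F i + s ^+ 2));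
    last by move=> i _; ring.
  rewrite !big_split/= sumr_const -[s ^+ 2 *+ _]mulr_natl -/n -!mulr_sumr -/s.
  by ring.
by rewrite pmulr_rge0// subr_ge0.
Qed.

Context (N d : nat).

Definition jump_edges (theta : grid N d -> R) :=
  [set e in grid_edges N d | theta e.1 != theta e.2]%SET.

Lemma sum_edges_sqr_diff_le (D : grid N d -> R) :
  \sum_(e in grid_edges N d) (D e.1 - D e.2) ^+ 2 <= 4 * d%:R * \sum_v D v ^+ 2.
Proof.
apply: (@le_trans _ _ (2 * (\sum_(e in grid_edges N d) D e.1 ^+ 2
    + \sum_(e in grid_edges N d) D e.2 ^+ 2))).
  rewrite -big_split mulr_sumr; apply: ler_sum => e _ /=.
  rewrite -subr_ge0.
  by rewrite (_ : _ - _ = (D e.1 + D e.2) ^+ 2) ?sqr_ge0//; ring.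
have h1 := sum_edges_tail_le (fun v => sqr_ge0 (D v)).
have h2 := sum_edges_head_le (fun v => sqr_ge0 (D v)).
move: h1 h2; move: (\sum_(e in _) _) (\sum_(e in _) _) (\sum_v _) => a b c.
by rewrite -mulrA; move: (d%:R * c) => x; lra.
Qed.

(** Deterministic part.  On an edge where theta is flat the noise term is
    dominated by the penalty.  On a jump edge there remains 2 kappa |grad|,
    split by Young's inequality with weight 16 d; since the sum of the squared
    gradients is at most 4 d times the squared norm, this gives back a quarter of
    the squared error.  The mean part gives back another quarter. *)
Lemma tv_oracle_inequality (theta thetahat eta : grid N d -> R) (kappa : R) :
  (0 < N)%N -> (0 < d)%N ->
  \sum_v (thetahat v - (theta v + eta v)) ^+ 2
    + kappa * \sum_(e in grid_edges N d) `|thetahat e.1 - thetahat e.2|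
  <= \sum_v eta v ^+ 2
    + kappa * \sum_(e in grid_edges N d) `|theta e.1 - theta e.2| ->
  (forall e, e \in grid_edges N d -> 2 * `|\sum_v flow R e v * eta v| <= kappa) ->
  \sum_v (thetahat v - theta v) ^+ 2
  <= 32 * d%:R * kappa ^+ 2 * #|jump_edges theta|%:R
     + 8 * ((N ^ d)%:R^-1 * (\sum_v eta v) ^+ 2).
Proof.
move=> N0 d0 basic noise.
pose D v := thetahat v - theta v.
pose Z e := \sum_v flow R e v * eta v.
pose A := \sum_v D v ^+ 2; pose n : R := (N ^ d)%:R.
have n0 : 0 < n by rewrite ltr0n expn_gt0 N0.
have dR0 : 0 < d%:R :> R by rewrite ltr0n.
have noise_split : \sum_v eta v * D v
    = n^-1 * ((\sum_v eta v) * (\sum_v D v))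
      + \sum_(e in grid_edges N d) Z e * (D e.1 - D e.2).
  have Dv v : D v = n^-1 * \sum_w D w
      + \sum_(e in grid_edges N d) flow R e v * (D e.1 - D e.2).
    by rewrite flow_divergence// addrC subrK.
  under eq_bigr do rewrite Dv mulrDr.
  rewrite big_split/= -mulr_suml mulrCA; congr (_ + _).
  under eq_bigr do rewrite mulr_sumr.
  rewrite exchange_big/=; apply: eq_bigr => e _.
  by rewrite mulr_suml; apply: eq_bigr => v _; ring.
have expand : \sum_v (thetahat v - (theta v + eta v)) ^+ 2
    = A - 2 * \sum_v eta v * D v + \sum_v eta v ^+ 2.
  rewrite mulr_sumr -sumrB -big_split/=; apply: eq_bigr => v _.
  by rewrite /D; ring.
have edge e : e \in grid_edges N d ->
    2 * (Z e * (D e.1 - D e.2))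
    + kappa * (`|theta e.1 - theta e.2| - `|thetahat e.1 - thetahat e.2|)
    <= (if theta e.1 != theta e.2 then 16 * d%:R * kappa ^+ 2 else 0)
       + (16 * d%:R)^-1 * (D e.1 - D e.2) ^+ 2.
  move=> eE; have Ze := noise e eE; rewrite -/(Z e) in Ze.
  have k0 : 0 <= kappa by apply: le_trans Ze; rewrite mulr_ge0.
  have DE : D e.1 - D e.2 = (thetahat e.1 - thetahat e.2) - (theta e.1 - theta e.2).
    by rewrite /D; ring.
  have ZD : 2 * (Z e * (D e.1 - D e.2)) <= kappa * `|D e.1 - D e.2|.
    apply: le_trans (ler_norm _) _.
    by rewrite !normrM (ger0_norm (ler0n _ 2)) mulrA ler_wpM2r.
  have sq0 : 0 <= (16 * d%:R)^-1 * (D e.1 - D e.2) ^+ 2.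
    by rewrite mulr_ge0 ?sqr_ge0// invr_ge0 mulr_ge0.
  case: eqP => [th|_] /=.
    rewrite th subrr normr0 !add0r mulrN.
    apply: le_trans sq0; rewrite subr_le0 (le_trans ZD)//.
    by rewrite DE th subrr subr0.
  have tri : `|theta e.1 - theta e.2| - `|thetahat e.1 - thetahat e.2|
      <= `|D e.1 - D e.2|.
    by rewrite DE [leRHS]distrC; exact: lerB_dist.
  have ktri := ler_wpM2l k0 tri.
  apply: (@le_trans _ _ (2 * kappa * `|D e.1 - D e.2|)); first by lra.
  rewrite -[(D e.1 - D e.2) ^+ 2]real_normK ?num_real//.
  move: (`|D e.1 - D e.2|) => x; rewrite -subr_ge0.
  rewrite (_ : _ - _ = (16 * d%:R)^-1 * (16 * d%:R * kappa - x) ^+ 2).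
    by rewrite mulr_ge0 ?sqr_ge0// invr_ge0 mulr_ge0.
  by field; rewrite gt_eqF.
have edges : 2 * (\sum_(e in grid_edges N d) Z e * (D e.1 - D e.2))
    + kappa * (\sum_(e in grid_edges N d) `|theta e.1 - theta e.2|
      - \sum_(e in grid_edges N d) `|thetahat e.1 - thetahat e.2|)
    <= 16 * d%:R * kappa ^+ 2 * #|jump_edges theta|%:R + 4^-1 * A.
  rewrite -sumrB !mulr_sumr -big_split/=.
  apply: (le_trans (ler_sum _ edge)); rewrite big_split/=; apply: lerD.
    rewrite -big_mkcondr/= sumr_const [leRHS]mulr_natr ler_wpMn2l//.
      by rewrite mulr_ge0 ?sqr_ge0// mulr_ge0.
    by rewrite leq_eqVlt; apply/orP; left; rewrite -cardsE; apply/eqP;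
      apply: eq_card => e; rewrite !finset.inE.
  rewrite -mulr_sumr ler_pdivrMl ?mulr_gt0//.
  have DA : _ <= 4 * d%:R * A := sum_edges_sqr_diff_le D.
  apply: (le_trans DA); rewrite le_eqVlt; apply/orP; left; apply/eqP.
  by rewrite -mulr_sumr -/A; field.
(* Young's inequality and Cauchy-Schwarz for the component along constants. *)
have mean : 2 * (n^-1 * ((\sum_v eta v) * (\sum_v D v)))
    <= 4 * (n^-1 * (\sum_v eta v) ^+ 2) + 4^-1 * A.
  have := sqr_sum_le_card D; rewrite card_grid -/n -/A.
  move: (\sum_v eta v) (\sum_v D v) => x y yA.
  have : n^-1 * y ^+ 2 <= A by rewrite ler_pdivrMl.
  have : 0 <= n^-1 * (2 * x - 2^-1 * y) ^+ 2.
    by rewrite mulr_ge0 ?sqr_ge0// invr_ge0 ltW.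
  rewrite (_ : n^-1 * (2 * x - 2^-1 * y) ^+ 2 = 4 * (n^-1 * x ^+ 2)
    - 2 * (n^-1 * (x * y)) + 4^-1 * (n^-1 * y ^+ 2)); last by field; rewrite gt_eqF.
  by move: (n^-1 * _) (n^-1 * _) (n^-1 * _) => a b c; lra.
rewrite -/A.
have -> : 32 * d%:R * kappa ^+ 2 * #|jump_edges theta|%:R
    = 2 * (16 * d%:R * kappa ^+ 2 * #|jump_edges theta|%:R) by ring.
move: basic; rewrite expand noise_split mulrDr => basic.
move: basic edges mean; rewrite -/n.
move: (n^-1 * _) (n^-1 * _) => a b.
move: (\sum_(e in _) _) (\sum_(e in _) _) (\sum_(e in _) _) => x y z.
rewrite (mulrBr kappa); move: (kappa * y) (kappa * z) (_ * #|_|%:R) (\sum_v _).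
by move=> ky kz J s; lra.
Qed.

End oracle.

(** * Jumps of a piecewise constant function *)

Section boundary_count.
Context (R : realType).

Lemma norm2_scale (m p : nat) (c : R) (A : 'M[R]_(m, p)) :
  norm2 (c *: A) = `|c| * norm2 A.
Proof.
rewrite /norm2 -sqrtr_sqr -sqrtrM ?sqr_ge0//; congr Num.sqrt.
rewrite mulr_sumr; apply: eq_bigr => i _; rewrite mulr_sumr.
by apply: eq_bigr => j _; rewrite mxE exprMn.
Qed.

Lemma coord_le_norm2 (d : nat) (A : 'rV[R]_d) (k : 'I_d) :
  `|A ord0 k| <= norm2 A.
Proof.
rewrite -sqrtr_sqr /norm2 ler_sqrt; last first.
  by rewrite !sumr_ge0// => i _; rewrite sumr_ge0// => j _; exact: sqr_ge0.
rewrite big_ord1 (bigD1 k)//= lerDl sumr_ge0// => j _; exact: sqr_ge0.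
Qed.

(** Local constancy gives a zero derivative, and the mean value theorem does the
    rest. *)
Lemma locally_constant_segment (g : R -> R) :
  (forall s, 0 <= s <= 1 ->
     exists2 e : R, 0 < e & forall s', `|s' - s| < e -> g s' = g s) ->
  g 1 = g 0.
Proof.
move=> loc.
have near_cst (s : R) : 0 <= s <= 1 -> \forall s' \near s, g s' = g s.
  move=> /loc[e e0 ge]; near=> s'; apply: ge; rewrite distrC.
  by near: s'; exact: cvgr_dist_lt.
have der (s : R) : s \in `]0, 1[ -> is_derive s (1 : R) g ((fun=> 0) s).
  rewrite in_itv/= => /andP[s0 s1].
  have s01 : 0 <= s <= 1 by rewrite !ltW.
  apply: (near_eq_is_derive (f := cst (g s))).
  by have := near_cst s s01; apply: filterS => s' ->.
have cont : {within `[0 : R, 1], continuous g}.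
  apply: continuous_in_subspaceT => s; rewrite inE/= in_itv/= => s01.
  by apply: cvg_near_cst; exact: near_cst.
have [c _] := MVT_segment ler01 der cont.
by rewrite mul0r => /eqP; rewrite subr_eq0 => /eqP.
Unshelve. all: by end_near. Qed.

Lemma unit_cube_segment (d : nat) (x y : 'rV[R]_d) (s : R) :
  unit_cube x -> unit_cube y -> 0 <= s <= 1 -> unit_cube (x + s *: (y - x)).
Proof.
move=> xc yc /andP[s0 s1] k; rewrite !mxE.
have /andP[x0 x1] := xc k; have /andP[y0 y1] := yc k.
by apply/andP; split; nra.
Qed.

Lemma jump_segment_meets_boundary (d : nat) (f : 'rV[R]_d -> R)
    (B : set 'rV[R]_d) (x y : 'rV[R]_d) :
  (forall x, (unit_cube `\` B) x ->
     exists2 e : R, 0 < e & forall y, norm2 (y - x) < e -> f x = f y) ->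
  unit_cube x -> unit_cube y -> f x <> f y ->
  exists2 s : R, 0 <= s <= 1 & B (x + s *: (y - x)).
Proof.
move=> loc xc yc fxy; apply: contrapT => noB; apply: fxy.
pose g s := f (x + s *: (y - x)).
suff : g 1 = g 0 by rewrite /g scale1r scale0r addr0 addrC subrK.
apply: locally_constant_segment => s s01.
have [e e0 fe] : exists2 e : R, 0 < e &
    forall z, norm2 (z - (x + s *: (y - x))) < e -> f (x + s *: (y - x)) = f z.
  apply: loc; split; first exact: unit_cube_segment.
  by move=> Bs; apply: noB; exists s.
have n0 : 0 <= norm2 (y - x) by exact: sqrtr_ge0.
have n1 : 0 < norm2 (y - x) + 1 by lra.
exists (e / (norm2 (y - x) + 1)); first by rewrite divr_gt0.
move=> s' s's; rewrite /g; apply/esym/fe.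
rewrite opprD addrACA subrr add0r -scalerBl norm2_scale.
move: s's; rewrite ltr_pdivlMr//; apply: le_lt_trans.
by rewrite ler_wpM2l// lerDl.
Qed.

(** Were all covers of more than x balls, the infimum would be at least
    floor x + 1, the numbers of balls being integers. *)
Lemma covering_number_le (d : nat) (B : set 'rV[R]_d) (r x : R) :
  0 <= x -> (covering_number B r <= x%:E)%E ->
  exists k : nat, k%:R <= x /\ exists a : 'I_k -> 'rV[R]_d,
    B `<=` \bigcup_(j in [set: 'I_k]) ball2 (a j) r.
Proof.
move=> x0 cov; apply: contrapT => nok.
suff : ((Num.truncn x).+1%:R%:E <= covering_number B r)%E.
  move=> /le_trans/(_ cov); rewrite lee_fin leNgt.
  by rewrite truncnS_gt.
apply: le_ereal_inf_tmp => _ [k [a ka] <-]; rewrite lee_fin ler_nat leqNgt.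
apply/negP; rewrite ltnS => kx; apply: nok; exists k; split; last by exists a.
by apply: (@le_trans _ _ (Num.truncn x)%:R); rewrite ?ler_nat ?truncn_le.
Qed.

(** The shift by one is that of the grid points, with coordinates in 1, ..., N. *)
Definition in_window (q : R) (c : nat) : bool := `|c.+1%:R - q| <= 2.

Lemma card_grid_window (N d : nat) (q : 'I_d -> R) :
  (#|[set u : grid N d | [forall k, in_window (q k) (u k)]]%SET| <= 5 ^ d)%N.
Proof.
have -> : #|[set u : grid N d | [forall k, in_window (q k) (u k)]]%SET|
    = (\prod_(k < d) \sum_(c < N) in_window (q k) c)%N.
  rewrite bigA_distr_bigA/= -sum1_card big_mkcond/=; apply: eq_bigr => u _.
  rewrite finset.inE; case: forallP => h.
    by rewrite big1// => k _; rewrite h.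
  have /existsNP[k /negP/negbTE hk] := h.
  by rewrite (bigD1 k)//= hk mul0n.
rewrite -[d in leqRHS]card_ord -prod_nat_const; apply: leq_prod => k _.
have -> : (\sum_(c < N) in_window (q k) c = 
    #|[set c : 'I_N | in_window (q k) c]%SET|)%N.
  rewrite -sum1_card [RHS]big_mkcond/=; apply: eq_bigr => c _.
  by rewrite finset.inE; case: ifP.
apply: card_ord_spread => i j; rewrite !finset.inE /in_window !ler_norml => /andP[i1 i2].
move=> /andP[j1 j2] _; rewrite -(ler_nat R) natrD.
by move: i1 i2 j1 j2; rewrite -!(natr1 (nat_of_ord _)); lra.
Qed.

Lemma grid_point_unit_cube (N d : nat) (u : grid N d) : unit_cube (grid_point R u).
Proof.
move=> k; rewrite mxE; have kN := ltn_ord (u k).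
have N0 : 0 < N%:R :> R by rewrite ltr0n; lia.
by rewrite divr_ge0//= ler_pdivrMr// mul1r ler_nat.
Qed.

(** A ball of radius 1 / N meeting the edge is within 1 of a point of the edge in
    the scale of the grid, hence within 2 of both endpoints. *)
Lemma edge_point_window (N d : nat) (u v : grid N d) (a : 'rV[R]_d) (s : R)
    (k : 'I_d) :
  grid_step u v -> 0 <= s <= 1 ->
  ball2 a N%:R^-1 (grid_point R u + s *: (grid_point R v - grid_point R u)) ->
  in_window (N%:R * a ord0 k) (u k) /\ in_window (N%:R * a ord0 k) (v k).
Proof.
move=> uv /andP[s0 s1] ball; have kN := ltn_ord (u k).
have N0 : 0 < N%:R :> R by rewrite ltr0n; lia.
have := le_trans (coord_le_norm2 _ k) ball; rewrite !mxE.
rewrite -(ler_pM2l N0) mulfV ?gt_eqF// -{1}(ger0_norm (ltW N0)) -normrM.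
set p : R := (u k).+1%:R; set q : R := (v k).+1%:R; set b := a ord0 k.
have -> : N%:R * (p / N%:R + s * (q / N%:R - p / N%:R) - b)
    = p + s * (q - p) - N%:R * b.
  by field; rewrite gt_eqF.
have pq : p <= q <= p + 1.
  have /existsP[l /andP[/eqP vl /forallP off]] := uv.
  rewrite /p /q; have [->|kl] := eqVneq k l.
    by rewrite vl -[X in _ <= X <= _]natr1 lexx andbT lerDl.
  by have /implyP/(_ kl)/eqP -> := off k; rewrite lexx lerDl ler01.
move: (N%:R * b) pq => c /andP[pq1 pq2].
by rewrite /in_window -/p -/q !ler_norml => /andP[h1 h2]; split; apply/andP; split; nra.
Qed.

(** The radius 1 / N of the cover matches the mesh: each ball then meets boundedly
    many edges, both endpoints lying in a cube of 5^d vertices. *)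
Lemma card_jump_edges_le (N d : nat) (beta : R) (f : 'rV[R]_d -> R) :
  (0 < N)%N -> 0 < beta -> piecewise_constant beta f ->
  #|jump_edges (fun u : grid N d => f (grid_point R u))|%:R
  <= 25 ^+ d * (beta * N%:R ^+ d.-1).
Proof.
move=> N0 beta0 [B [Bcube loc cov]].
have NR0 : 0 < N%:R :> R by rewrite ltr0n.
have r01 : 0 < (N%:R^-1 : R) <= 1.
  by rewrite invr_gt0 NR0 invf_le1// ler1n.
have x0 : 0 <= beta / N%:R^-1 ^+ d.-1.
  by rewrite divr_ge0 ?ltW// exprn_gt0// invr_gt0.
have [k [kx [a aB]]] := covering_number_le x0 (cov _ r01).
pose U j := [set u : grid N d |
  [forall i, in_window (N%:R * a j ord0 i) (u i)]]%SET.
have sub : jump_edges (fun u : grid N d => f (grid_point R u))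
    \subset (\bigcup_(j : 'I_k) finset.setX (U j) (U j))%SET.
  apply/fintype.subsetP => -[u v]; rewrite !finset.inE/= => /andP[uv /eqP fuv].
  have [s s01 Bs] := jump_segment_meets_boundary loc
    (grid_point_unit_cube u) (grid_point_unit_cube v) fuv.
  have [j _ js] := aB _ Bs.
  apply/bigcupP; exists j => //; rewrite !finset.inE/=.
  by apply/andP; split; apply/forallP => i;
    have [] := edge_point_window i uv s01 js.
have card : (#|jump_edges (fun u : grid N d => f (grid_point R u))|
    <= k * 25 ^ d)%N.
  apply: (leq_trans (subset_leq_card sub)).
  have cardU : (#|(\bigcup_(j : 'I_k) finset.setX (U j) (U j))%SET|
      <= \sum_j #|finset.setX (U j) (U j)|)%N.
    elim/big_rec2: _ => [|j m V _ Vm]; first by rewrite cards0.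
    by rewrite (leq_trans (leq_card_setU _ _))// leq_add2l.
  apply: (leq_trans cardU).
  rewrite -[k in leqRHS]card_ord -sum_nat_const; apply: leq_sum => j _.
  by rewrite cardsX -[25%N]/(5 * 5)%N expnMn leq_mul// card_grid_window.
apply: (@le_trans _ _ (k * 25 ^ d)%:R); first by rewrite ler_nat.
rewrite natrM natrX mulrC ler_wpM2l ?exprn_ge0//.
by move: kx; rewrite exprVn invrK.
Qed.

End boundary_count.

(** * The noise event *)

Lemma measure_bigsetU_le (disp : measure_display) (T : measurableType disp)
    (R : realType) (mu : {measure set T -> \bar R}) (I : Type) (s : seq I)
    (Q : pred I) (F : I -> set T) :
  (forall i, measurable (F i)) ->
  (mu (\big[setU/set0]_(i <- s | Q i) F i) <= \sum_(i <- s | Q i) mu (F i))%E.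
Proof.
move=> mF; elim: s => [|i s IH]; first by rewrite !big_nil measure0.
rewrite !big_cons; case: ifP => // _.
have mU : measurable (\big[setU/set0]_(j <- s | Q j) F j).
  exact: bigsetU_measurable.
exact: le_trans (measureU2 mu (mF i) mU) (leeD _ _).
Qed.

Section noise_event.
Context (R : realType) (d : nat) (d2 : (2 <= d)%N).

Definition energy_const : R := 4 * d%:R ^+ 2 * 192 ^+ d.

(** Chosen so that (kappa / 2)^2 / (2 V) = 2 d L for the threshold kappa and the
    variance bound V of [noise_event]. *)
Definition noise_const : R := Num.sqrt (16 * d%:R * energy_const).

Lemma energy_const_gt0 : 0 < energy_const.
Proof. by rewrite !mulr_gt0 ?exprn_gt0 ?ltr0n//; lia. Qed.

Lemma noise_const_sqr : noise_const ^+ 2 = 16 * d%:R * energy_const.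
Proof.
have K0 := ltW energy_const_gt0.
by rewrite sqr_sqrtr// !mulr_ge0.
Qed.

Lemma noise_const_gt0 : 0 < noise_const.
Proof. by rewrite sqrtr_gt0 !mulr_gt0 ?energy_const_gt0 ?ltr0n//; lia. Qed.

Lemma flow_energy_le (N : nat) (e : grid N d * grid N d) : (2 <= N)%N ->
  \sum_v flow R e v ^+ 2 <= energy_const * rfactor R d (N ^ d).
Proof.
move=> N2; apply: le_trans (flow_energy_sum R e _) _; first by lia.
have -> : energy_const * rfactor R d (N ^ d)
    = 2 * d%:R ^+ 2 * 192 ^+ d * (2 * rfactor R d (N ^ d)).
  by rewrite /energy_const; ring.
by rewrite ler_wpM2l ?power_sum_le_rfactor//.
Qed.

Lemma grid_step_side (N : nat) (x y : grid N d) : grid_step x y -> (2 <= N)%N.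
Proof.
move=> /existsP[k /andP[/eqP yx _]].
by have := ltn_ord (y k); have := ltn_ord (x k); lia.
Qed.

Lemma rfactor_gt0 (N : nat) : (2 <= N)%N -> 0 < rfactor R d (N ^ d).
Proof.
move=> N2; rewrite /rfactor; case: ifP => // _; rewrite ln_gt0// ltr1n.
by rewrite (leq_trans N2)// -[leqLHS]expn1 leq_exp2l; lia.
Qed.

Lemma sum_grid_enum (N : nat) (F : grid N d -> R) :
  \sum_v F v = \sum_(i < #|grid N d|) F (enum_val i).
Proof. by rewrite -big_enum_val. Qed.

(** The exponent 2 d L beats the number d n of edges: one factor exp (- L) equals
    delta / (e n), and since L >= 1 the others contribute at most 1 / (2 d). *)
Lemma union_bound_exp (n : nat) (delta : R) : (1 <= n)%N -> 0 < delta < 1 ->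
  (d * n)%:R * (2 * expR (- (2 * d%:R * ln (expR 1 * n%:R / delta)))) <= delta.
Proof.
move=> n1 /andP[del0 del1]; set L := ln _.
have n0 : 0 < n%:R :> R by rewrite ltr0n.
have d0 : 0 < d%:R :> R by rewrite ltr0n; lia.
have dR1 : 2 <= d%:R :> R by rewrite ler_nat.
have arg0 : 0 < expR 1 * n%:R / delta by rewrite divr_gt0// mulr_gt0 ?expR_gt0.
have eL : expR (- L) = delta / (expR 1 * n%:R).
  by rewrite expRN lnK ?posrE// invf_div.
have L1 : 1 <= L.
  rewrite -[1 in leLHS](expRK 1) ler_ln ?posrE ?expR_gt0//.
  rewrite -mulrA ler_peMr ?expR_ge0// ler_pdivlMr// mul1r.
  by rewrite (le_trans (ltW del1))// ler1n.
have -> : - (2 * d%:R * L) = - L + - ((2 * d%:R - 1) * L) by ring.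
have h1 : expR (- ((2 * d%:R - 1) * L)) <= (2 * d%:R)^-1.
  rewrite expRN lef_pV2 ?posrE ?expR_gt0 ?mulr_gt0//.
  have -> : 2 * d%:R = 1 + (2 * d%:R - 1) :> R by ring.
  apply: le_trans (expR_ge1Dx _) _; rewrite ler_expR; nra.
rewrite expRD eL natrM.
apply: (@le_trans _ _ (d%:R * n%:R * (2 * (delta / (expR 1 * n%:R) * (2 * d%:R)^-1)))).
  have q0 : 0 <= delta / (expR 1 * n%:R).
    by rewrite ltW// divr_gt0// mulr_gt0 ?expR_gt0.
  apply: ler_wpM2l; first by rewrite mulr_ge0.
  by apply: ler_wpM2l => //; exact: ler_wpM2l.
have -> : d%:R * n%:R * (2 * (delta / (expR 1 * n%:R) * (2 * d%:R)^-1))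
    = delta / expR 1.
  by field; rewrite !gt_eqF// expR_gt0.
have e1 : 1 <= expR 1 :> R by rewrite -[leLHS]expR0 ler_expR.
by rewrite ler_pdivrMr ?expR_gt0// ler_peMr// ltW.
Qed.

Lemma mean_tail_exp (delta : R) : 0 < delta < 1 ->
  2 * expR (- (2 * ln (expR 1 / delta))) <= delta.
Proof.
move=> /andP[del0 del1].
have e2 : 2 <= expR 1 :> R by have := @expR_ge1Dx R 1; lra.
have e0 : 0 < expR 1 :> R by exact: expR_gt0.
have -> : 2 * ln (expR 1 / delta) = ln (expR 1 / delta) + ln (expR 1 / delta) by ring.
rewrite opprD expRD !expRN lnK ?posrE ?divr_gt0// invf_div.
have q0 : 0 < delta / expR 1 by rewrite divr_gt0.
have q2 : 2 * (delta / expR 1) <= delta.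
  by rewrite mulrA ler_pdivrMr// mulrC ler_wpM2l// ltW.
have q1 : delta / expR 1 <= 1 by rewrite ler_pdivrMr//; lra.
by nra.
Qed.

(** The failure probability delta is spent once on the edges and once on the mean.
    An edge exists only when N >= 2, which makes r_d(n) positive; for N = 1 and
    d = 2 the threshold kappa is 0 but there is nothing to bound. *)
Lemma noise_event (N : nat) (delta sigma : R) (disp : measure_display)
    (T : measurableType disp) (P : probability T R)
    (eps : 'I_#|grid N d| -> {RV P >-> R}) :
  (1 <= N)%N -> 0 < delta < 1 -> 0 < sigma -> isotropic_gaussian sigma eps ->
  let n := (N ^ d)%N in
  let kappa := noise_const * sigma
    * Num.sqrt (rfactor R d n * ln (expR 1 * n%:R / delta)) in
  exists A : set T, [/\ measurable A, ((1 - 2 * delta)%:E <= P A)%E &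
    forall w, A w ->
      (forall e, e \in grid_edges N d ->
         2 * `|\sum_v flow R e v * eps (enum_rank v) w| <= kappa) /\
      (\sum_v eps (enum_rank v) w) ^+ 2
        <= 4 * sigma ^+ 2 * n%:R * ln (expR 1 / delta)].
Proof.
move=> N1 del01 s0 gauss n kappa; have /andP[del0 del1] := del01.
have n1 : (1 <= n)%N by rewrite expn_gt0 N1.
have n0 : 0 < n%:R :> R by rewrite ltr0n.
pose L := ln (expR 1 * n%:R / delta).
have ell0 : 0 < ln (expR 1 / delta).
  rewrite ln_gt0// ltr_pdivlMr// mul1r (lt_trans del1)//.
  by rewrite -expR0 ltr_expR.
have L0 : 0 < L.
  rewrite ln_gt0// ltr_pdivlMr// mul1r (lt_le_trans del1)//.
  by rewrite mulr_ege1 ?ler1n// -expR0 ler_expR.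
pose tau := 2 * sigma * Num.sqrt (n%:R * ln (expR 1 / delta)).
pose a e (i : 'I_#|grid N d|) : R := flow R e (enum_val i).
pose bad e : set T := [set w | kappa / 2 <= `|\sum_i a e i * eps i w|].
pose bad0 : set T := [set w | tau <= `|\sum_i 1 * eps i w|].
have mbad e : measurable (bad e) by exact: measurable_linear_tail.
have mbad0 : measurable bad0 by exact: measurable_linear_tail.
have Pbad e : e \in grid_edges N d ->
    (P (bad e) <= (2 * expR (- (2 * d%:R * L)))%:E)%E.
  rewrite finset.inE => /grid_step_side N2.
  have r0 := rfactor_gt0 N2; have K0 := energy_const_gt0.
  pose V := sigma ^+ 2 * (energy_const * rfactor R d n).
  have V0 : 0 < V by rewrite mulr_gt0 ?exprn_gt0// mulr_gt0.
  have k0 : 0 < kappa / 2.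
    by rewrite divr_gt0// /kappa -/L !mulr_gt0 ?noise_const_gt0// sqrtr_gt0 mulr_gt0.
  have aV : sigma ^+ 2 * \sum_i a e i ^+ 2 <= V.
    rewrite ler_wpM2l ?sqr_ge0// -(sum_grid_enum (fun v => flow R e v ^+ 2)).
    exact: flow_energy_le.
  have -> : 2 * d%:R * L = (kappa / 2) ^+ 2 / (2 * V).
    rewrite expr_div_n /kappa -/L !exprMn noise_const_sqr sqr_sqrtr; last first.
      by rewrite mulr_ge0 ?ltW.
    by rewrite /V; field; rewrite !gt_eqF.
  exact: (gaussian_tail s0 gauss V0 aV k0).
have Pbad0 : (P bad0 <= delta%:E)%E.
  have V0 : 0 < n%:R * sigma ^+ 2 by rewrite mulr_gt0 ?exprn_gt0.
  have tau0 : 0 < tau by rewrite !mulr_gt0// sqrtr_gt0 mulr_gt0.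
  have aV : sigma ^+ 2 * \sum_(i < #|grid N d|) 1 ^+ 2 <= n%:R * sigma ^+ 2.
    by rewrite expr1n sumr_const card_ord card_grid mulrC.
  apply: le_trans (gaussian_tail s0 gauss V0 aV tau0) _; rewrite lee_fin.
  have -> : tau ^+ 2 / (2 * (n%:R * sigma ^+ 2)) = 2 * ln (expR 1 / delta).
    rewrite /tau !exprMn sqr_sqrtr ?mulr_ge0 ?ltW//.
    by field; rewrite !gt_eqF.
  exact: mean_tail_exp.
pose badU : set T := \big[setU/set0]_(e in grid_edges N d) bad e.
have mbadU : measurable badU by apply: bigsetU_measurable.
have PbadU : (P badU <= delta%:E)%E.
  apply: le_trans (measure_bigsetU_le _ _ _ mbad) _.
  apply: (@le_trans _ _ (\sum_(e in grid_edges N d)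
      (2 * expR (- (2 * d%:R * L)))%:E)%E); first exact: lee_sum.
  rewrite sumEFin lee_fin sumr_const -[_ *+ _]mulr_natl.
  apply: le_trans (union_bound_exp n1 del01); rewrite -/L.
  rewrite ler_wpM2r ?mulr_ge0 ?expR_ge0// ler_nat.
  exact: card_grid_edges_le.
exists (~` (bad0 `|` badU)); split.
- by apply: measurableC; exact: measurableU.
- rewrite probability_setC; last exact: measurableU.
  have PU : (P (bad0 `|` badU) <= (delta + delta)%:E)%E.
    apply: le_trans (measureU2 P mbad0 mbadU) _.
    by rewrite EFinD leeD.
  have -> : 1 - 2 * delta = 1 - (delta + delta) by ring.
  by rewrite EFinB leeB.
- move=> w /= /not_orP[nb0 nbU]; split.
    move=> e eE; rewrite sum_grid_enum.
    under eq_bigr do rewrite enum_valK.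
    have nbe : ~ bad e w.
      by move=> be; apply: nbU; rewrite /badU (bigD1 e)//=; left.
    move: nbe => /negP; rewrite /bad/= -ltNge ltr_pdivlMr// mulrC => /ltW.
    by [].
  rewrite (sum_grid_enum (fun v => eps (enum_rank v) w)).
  under eq_bigr do rewrite enum_valK.
  move: nb0 => /negP; rewrite /bad0/= -ltNge => lt0.
  have -> : 4 * sigma ^+ 2 * n%:R * ln (expR 1 / delta) = tau ^+ 2.
    rewrite /tau !exprMn sqr_sqrtr ?mulr_ge0 ?ltW//; ring.
  under eq_bigr do rewrite -[eps _ _]mul1r.
  have tau0 : 0 <= tau by apply: le_trans (ltW lt0).
  by rewrite -real_normK ?num_real// ler_sqr ?nnegrE// ltW.
Qed.

End noise_event.

(** * Conclusion *)

Section vectorization.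
Context (R : realType) (N d : nat).

Lemma sum_grid_rank (G : 'I_#|grid N d| -> R) :
  \sum_i G i = \sum_v G (enum_rank v).
Proof. by rewrite sum_grid_enum; apply: eq_bigr => i _; rewrite enum_valK. Qed.

Lemma norm2_sqr_grid (A : 'cV[R]_#|grid N d|) :
  norm2 A ^+ 2 = \sum_v A (enum_rank v) ord0 ^+ 2.
Proof.
rewrite /norm2 sqr_sqrtr; last first.
  by apply: sumr_ge0 => i _; apply: sumr_ge0 => j _; exact: sqr_ge0.
by rewrite -(sum_grid_rank (fun i => A i ord0 ^+ 2)); apply: eq_bigr => i _;
  rewrite big_ord1.
Qed.

Lemma norm1_incidence (A : 'cV[R]_#|grid N d|) :
  norm1 (incidence R N d *m A)
  = \sum_(e in grid_edges N d)
      `|A (enum_rank e.1) ord0 - A (enum_rank e.2) ord0|.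
Proof.
rewrite /norm1 [RHS]big_enum_val; apply: eq_bigr => i _; rewrite big_ord1.
congr (`|_|); rewrite mxE (sum_grid_rank (fun j => incidence R N d i j * A j ord0)).
have pick (x : grid N d) :
    \sum_v (v == x)%:R * A (enum_rank v) ord0 = A (enum_rank x) ord0.
  rewrite (bigD1 x)//= eqxx mul1r big1 ?addr0// => v /negbTE ->.
  by rewrite mul0r.
rewrite -!pick -sumrB; apply: eq_bigr => v _.
by rewrite mxE enum_rankK mulrBl.
Qed.

(** The objective in terms of functions on the grid, with the penalty level
    kappa = n lambda. *)
Lemma scaled_tv_objective (lambda : R) (y A : 'cV[R]_#|grid N d|) : (0 < N)%N ->
  (N ^ d)%:R * tv_objective lambda y A
  = \sum_v (A (enum_rank v) ord0 - y (enum_rank v) ord0) ^+ 2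
    + (N ^ d)%:R * lambda * \sum_(e in grid_edges N d)
        `|A (enum_rank e.1) ord0 - A (enum_rank e.2) ord0|.
Proof.
move=> N0; have n0 : (N ^ d)%:R != 0 :> R by rewrite pnatr_eq0 expn_eq0; lia.
rewrite /tv_objective mulrDr mulVKf// mulrA norm1_incidence norm2_sqr_grid.
by congr (_ + _); apply: eq_bigr => v _; rewrite !mxE.
Qed.

End vectorization.

Theorem proposition23 (R : realType) (d : nat) (hd : (2 <= d)%N) :
  exists c C : R, [/\ 0 < c, 0 < C &
    forall (N : nat) (delta beta sigma : R) (fstar : 'rV[R]_d -> R)
           (disp : measure_display) (T : measurableType disp)
           (P : probability T R) (eps : 'I_#|grid N d| -> {RV P >-> R}),
      (1 <= N)%N -> 0 < delta < 1 -> 0 < beta -> 0 < sigma ->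
      piecewise_constant beta fstar ->
      isotropic_gaussian sigma eps ->
      let n := (N ^ d)%N in
      let L := ln (expR 1 * n%:R / delta) in
      let lambda := c * sigma * Num.sqrt (rfactor R d n * L) / n%:R in
      let y := fun w : T => sample N fstar + \col_v eps v w in
      forall (thetahat : T -> 'cV[R]_#|grid N d|) (fhat : T -> 'rV[R]_d -> R),
        (forall w, is_argmin (tv_objective lambda (y w)) (thetahat w)) ->
        (forall w (i : grid N d),
           fhat w (grid_point R i) = thetahat w (enum_rank i) ord0) ->
        with_prob_ge P (1 - 2 * delta)
          [set w | empirical_sqnorm N (fun x => fhat w x - fstar x)
             <= C * (sigma ^+ 2 * beta / (n%:R `^ (d%:R^-1))
                       * rfactor R d n * L
                     + sigma ^+ 2 / n%:R * ln (expR 1 / delta))]].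
Proof.
have d0 : (0 < d)%N by lia.
have c0 : 0 < noise_const R d by exact: noise_const_gt0.
pose C1 : R := 32 * d%:R * noise_const R d ^+ 2 * 25 ^+ d.
have C10 : 0 < C1 by rewrite !mulr_gt0 ?exprn_gt0 ?ltr0n.
exists (noise_const R d), (C1 + 32); split => //; first by rewrite addr_gt0.
move=> N delta beta sigma fstar disp T P eps N1 del01 beta0 s0 pc gauss.
move=> n L lambda y thetahat fhat argmin fhatE.
have n0 : 0 < n%:R :> R by rewrite ltr0n expn_gt0 N1.
have NR0 : 0 < N%:R :> R by rewrite ltr0n.
have /andP[del0 del1] := del01.
have [A [mA PA good]] := noise_event hd N1 del01 s0 gauss.
exists A; split => // w /good[noise mean] /=.
set kappa := noise_const R d * sigma * _ in noise.
have kappaE : n%:R * lambda = kappa.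
  by rewrite /lambda mulrC divfK// gt_eqF.
pose theta (v : grid N d) : R := fstar (grid_point R v).
pose that (v : grid N d) : R := thetahat w (enum_rank v) ord0.
pose eta v := eps (enum_rank v) w.
have thetaE v : sample N fstar (enum_rank v) ord0 = theta v.
  by rewrite mxE enum_rankK.
have basic : \sum_v (that v - (theta v + eta v)) ^+ 2
    + kappa * \sum_(e in grid_edges N d) `|that e.1 - that e.2|
  <= \sum_v eta v ^+ 2
    + kappa * \sum_(e in grid_edges N d) `|theta e.1 - theta e.2|.
  have := argmin w (sample N fstar); rewrite -(ler_pM2l n0).
  rewrite !scaled_tv_objective// kappaE.
  under eq_bigr do rewrite /y !mxE enum_rankK.
  under [X in _ <= X + _]eq_bigr => v _.
    rewrite /y !mxE enum_rankK opprD addrA subrr add0r sqrrN.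
    over.
  by under [X in _ <= _ + _ * X]eq_bigr do rewrite !thetaE.
have oracle := tv_oracle_inequality N1 d0 basic noise.
have jumps : #|jump_edges theta|%:R <= 25 ^+ d * (beta * N%:R ^+ d.-1).
  exact: card_jump_edges_le.
have ell0 : 0 < ln (expR 1 / delta).
  rewrite ln_gt0// ltr_pdivlMr// mul1r (lt_trans del1)//.
  by rewrite -[ltLHS]expR0 ltr_expR.
have L0 : 0 <= L.
  rewrite ln_ge0// ler_pdivlMr// mul1r (le_trans (ltW del1))//.
  rewrite mulr_ege1 ?ler1n ?expn_gt0 ?N1//.
  by rewrite -[leLHS]expR0 ler_expR.
have r0 : 0 <= rfactor R d n.
  by rewrite /rfactor; case: ifP => // _; rewrite ln_ge0// ler1n expn_gt0 N1.
have rootn : n%:R `^ (d%:R^-1) = N%:R :> R.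
  rewrite natrX -powR_mulrn ?ler0n// -powRrM mulfV ?powRr1//.
  by rewrite pnatr_eq0 -lt0n.
have nN : n%:R = N%:R * N%:R ^+ d.-1 :> R.
  by rewrite -exprS prednK// natrX.
have emp : empirical_sqnorm N (fun x => fhat w x - fstar x)
    = n%:R^-1 * \sum_v (that v - theta v) ^+ 2.
  by congr (_ * _); apply: eq_bigr => v _; rewrite fhatE.
rewrite emp rootn ler_pdivrMl//; apply: (le_trans oracle).
have k2 : kappa ^+ 2 = noise_const R d ^+ 2 * sigma ^+ 2 * (rfactor R d n * L).
  by rewrite /kappa -/n -/L !exprMn (sqr_sqrtr (mulr_ge0 r0 L0)).
have part1 : 32 * d%:R * kappa ^+ 2 * #|jump_edges theta|%:R
    <= n%:R * (C1 * (sigma ^+ 2 * beta / N%:R * rfactor R d n * L)).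
  have coef0 : 0 <= 32 * d%:R * kappa ^+ 2.
    by apply: mulr_ge0; [rewrite mulr_ge0|exact: sqr_ge0].
  apply: le_trans (ler_wpM2l coef0 jumps) _; rewrite k2.
  rewrite le_eqVlt; apply/orP; left; apply/eqP; rewrite nN /C1.
  by field; rewrite gt_eqF.
have part2 : 8 * (n%:R^-1 * (\sum_v eta v) ^+ 2)
    <= n%:R * (32 * (sigma ^+ 2 / n%:R * ln (expR 1 / delta))).
  have -> : n%:R * (32 * (sigma ^+ 2 / n%:R * ln (expR 1 / delta)))
      = 8 * (n%:R^-1 * (4 * sigma ^+ 2 * n%:R * ln (expR 1 / delta))).
    by field; rewrite gt_eqF.
  by rewrite ler_pM2l// ler_pM2l ?invr_gt0.
apply: (le_trans (lerD part1 part2)); rewrite -mulrDr ler_pM2l//.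
set X := sigma ^+ 2 * beta / _ * _ * _; set Y := sigma ^+ 2 / _ * _.
have s2 : 0 <= sigma ^+ 2 by exact: sqr_ge0.
have X0 : 0 <= X.
  do 2 apply: mulr_ge0 => //.
  exact: divr_ge0 (mulr_ge0 s2 (ltW beta0)) (ltW NR0).
have Y0 : 0 <= Y by apply: mulr_ge0; [exact: divr_ge0 s2 (ltW n0)|exact: ltW].
rewrite mulrDr !mulrDl; have := mulr_ge0 (ltW C10) Y0; lra.
Qed.
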